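(* Let $f^\circ=\mathbb 1_{[0,1)}$, $R>0$, let $1/2<s_\star<s^\star$ and let $\mathcal A$ be a set of strictly positive, non-increasing sequences bounded by $1$ with $\{(j^{-s})_{j\in\mathbb N}:s\in[s_\star,s^\star]\}\subseteq\mathcal A$. Assume $|\varphi_j|\sim j^{-p}$ for some $p>1/2$. Then for every $\alpha\in(0,1)$ there exist $n_\circ\in\mathbb N$ and $\underline A_\alpha\in(0,\infty)$ such that for all $n\ge n_\circ$ and $A\in[0,\underline A_\alpha]$, $$\inf_\Delta\sup_{a\in\mathcal A}\mathcal R\big(\Delta\mid\mathcal E_a^R,A\rho_a(\delta n)\big)\ge1-\alpha,\qquad\delta:=(\log\log n\vee1)^{-1/2},$$ the infimum being over all tests $\Delta$.
   Context: Identify the circle with $[0,1)$. $L^2:=L^2([0,1))$ is the space of square-integrable complex-valued functions on $[0,1)$ with $\langle h_1,h_2\rangle=\int_0^1h_1\overline{h_2}$ and norm $\|\cdot\|_{L^2}$. $e_j(x):=\exp(-\mathrm i2\pi jx)$, $h_j:=\langle h,e_j\rangle$ for $j\in\mathbb Z$. $\mathcal D$ is the set of real-valued probability densities on $[0,1)$ in $L^2$. Circular convolution $(f\circledast\varphi)(y)=\int_0^1f(y-s-\lfloor y-s\rfloor)\varphi(s)ds$. The error density $\varphi\in\mathcal D$ is fixed with $|\varphi_j|>0$ for all $j\in\mathbb Z$; $|\varphi_j|\sim j^{-p}$ means there are constants $0<c\le C$ with $cj^{-p}\le|\varphi_j|\le Cj^{-p}$ for all $j\in\mathbb N$ (recall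 $|\varphi_{-j}|=|\varphi_j|$). For $f\in\mathcal D$, $Y_1,\dots,Y_n$ i.i.d. with density $f\circledast\varphi$, joint law $\mathbb P_f$; a test is a measurable $\{0,1\}$-valued function of $(Y_1,\dots,Y_n)$. $[k]:=\{1,\dots,k\}$, $\nu_k:=(\sum_{|j|\in[k]}|\varphi_j|^{-4})^{1/4}$. $\rho_a(x):=\big(\min_{k\in\mathbb N}(a_k^2\vee\nu_k^2/x)\big)^{1/2}$ for $x>0$. $\mathcal E_a^R:=\{h\in L^2:2\sum_{j\in\mathbb N}a_j^{-2}|h_j|^2\le R^2\}$. Risk: $\mathcal R(\Delta\mid\mathcal E,\rho):=\mathbb P_{f^\circ}(\Delta=1)+\sup\{\mathbb P_f(\Delta=0):f\in\mathcal D,f-f^\circ\in\mathcal E,\|f-f^\circ\|_{L^2}\ge\rho\}$. *)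

(* Defs.v *)
From HB Require Import structures.
From mathcomp Require Import all_boot all_order all_algebra.
From mathcomp Require Import all_classical all_reals all_analysis.
Set Implicit Arguments. Unset Strict Implicit. Unset Printing Implicit Defensive.
Import Order.TTheory GRing.Theory Num.Theory numFieldNormedType.Exports.
Local Open Scope classical_set_scope.
Local Open Scope ring_scope.

Section defs.
Context {R : realType}.

(* the circle identified with [0,1), with Lebesgue measure *)
Definition I01 : set R := `[0%R, 1%R[%classic.
Definition Lint (h : R -> R) : R := \int[(@lebesgue_measure R)]_(x in I01) h x.

Definition inL2 (h : R -> R) : Prop :=
  measurable_fun I01 h /\
  (\int[(@lebesgue_measure R)]_(x in I01) ((h x) ^+ 2)%:E < +oo)%E.

Definition density (f : R -> R) : Prop :=
  inL2 f /\ (forall x, I01 x -> 0 <= f x) /\ Lint f = 1.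

Definition L2norm (h : R -> R) : R := Num.sqrt (Lint (fun x => h x ^+ 2)).

(* Fourier coefficient h_j = <h, e_j> = \int h(x) exp(i 2 pi j x) dx for real h:
   real part and imaginary part *)
Definition fre (h : R -> R) (j : int) : R :=
  Lint (fun x => h x * cos (2 * pi * j%:~R * x)).
Definition fim (h : R -> R) (j : int) : R :=
  Lint (fun x => h x * sin (2 * pi * j%:~R * x)).
Definition fabs2 (h : R -> R) (j : int) : R := fre h j ^+ 2 + fim h j ^+ 2.
Definition fabs (h : R -> R) (j : int) : R := Num.sqrt (fabs2 h j).

Definition frac (y : R) : R := y - (Num.floor y)%:~R.

Definition conv (f phi : R -> R) (y : R) : R :=
  Lint (fun s => f (frac (y - s)) * phi s).

Definition fcirc (x : R) : R := if (0 <= x) && (x < 1) then 1 else 0.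

Definition nu (phi : R -> R) (k : nat) : R :=
  powR (\sum_(1 <= j < k.+1) (fabs phi j%:Z ^- 4 + fabs phi (- j%:Z) ^- 4)) (4^-1).

(* rho_a(x) = ( min_{k in N} (a_k^2 \/ nu_k^2 / x) )^{1/2}; the minimum is
   written as an infimum (it is attained) *)
Definition rho (phi : R -> R) (a : nat -> R) (x : R) : R :=
  Num.sqrt (inf [set Num.max (a k ^+ 2) (nu phi k ^+ 2 / x)
                | k in [set k : nat | (0 < k)%N]]).

(* the ellipsoid E_a^r (sequences a indexed by j >= 1; a 0 is irrelevant) *)
Definition ellipsoid (a : nat -> R) (r : R) (h : R -> R) : Prop :=
  inL2 h /\
  (2%:E * \sum_(1 <= j <oo) (((a j) ^-2 * fabs2 h j%:Z)%:E) <= (r ^+ 2)%:E)%E.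

(* measurable rectangles in R^n, points of R^n being lists of length n *)
Definition boxes (n : nat) : set (set (seq R)) :=
  [set B | exists A : nat -> set R, (forall i, measurable (A i)) /\
     B = [set ys | size ys = n /\ forall i, (i < n)%N -> A i (nth 0 ys i)]].

(* a test based on n observations: a {0,1}-valued function measurable w.r.t.
   the product Borel sigma-algebra on R^n *)
Definition is_test (n : nat) (D : seq R -> bool) : Prop :=
  <<s boxes n >> [set ys | D ys].

(* integral of F against the product density prod_i g(y_i) on [0,1)^n,
   written as an iterated integral *)
Fixpoint iint (g : R -> R) (n : nat) (F : seq R -> \bar R) : \bar R :=
  match n with
  | 0 => F [::]
  | k.+1 => (\int[(@lebesgue_measure R)]_(y in I01)
              ((g y)%:E * iint g k (fun ys => F (y :: ys))))%E
  end.

(* P_f(D = b) where Y_1..Y_n iid with density f conv phi *)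
Definition Pr (phi : R -> R) (n : nat) (f : R -> R) (D : seq R -> bool)
  (b : bool) : \bar R :=
  iint (conv f phi) n (fun ys => ((D ys == b)%:R)%:E).

(* risk R(D | E, rho); the supremum of probabilities over an empty set is 0 *)
Definition alternatives (phi : R -> R) (n : nat) (D : seq R -> bool)
  (E : (R -> R) -> Prop) (rh : R) : set (\bar R) :=
  [set P | P = 0%E \/ exists f, density f /\
       E (fun x => f x - fcirc x) /\ rh <= L2norm (fun x => f x - fcirc x) /\
       P = Pr phi n f D false].

Definition risk (phi : R -> R) (n : nat) (D : seq R -> bool)
  (E : (R -> R) -> Prop) (rh : R) : \bar R :=
  (Pr phi n fcirc D true + ereal_sup (alternatives phi n D E rh))%E.

Definition delta (n : nat) : R :=
  powR (Num.max (ln (ln n%:R)) 1) (- 2^-1).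

End defs.

(* Main.v *)
Require Import Defs.
From HB Require Import structures.
From mathcomp Require Import all_boot all_order all_algebra.
From mathcomp Require Import all_classical all_reals all_analysis.
From mathcomp Require Import measurable_realfun ring lra zify.

(** Le Cam's method with a mixture of alternatives. For [k = 2 ^ i], put
    [f = 1 + sum_(k <= j < 2 k) 2 theta tau_j cos (2 pi j x)] with random signs
    [tau_j] and [theta ~ k ^ (- s - 1/2)], where the smoothness [s] is tied to
    [k] by [k ^ (2 s + 2 p + 1/2) = delta n]. As [i] runs over an interval of
    length of order [ln n], [s] stays in [[sl, su]], so a uniform mixture over
    [i] and the signs is available to the adversary. Under [1] the observations
    are uniform, hence the second moment of the likelihood ratio is the average
    of [(\int g g') ^ n] over pairs of convolved alternatives. Different dyadic
    blocks have disjoint Fourier supports, so they contribute exactly [1];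
    pairs from one block contribute at most [exp (ln (ln n) / 2)] after
    averaging over the signs. With [N ~ ln n] blocks the chi-square distance is
    thus of order [(ln n) ^ (- 1/2)] and tends to [0]. *)

Set Implicit Arguments. Unset Strict Implicit. Unset Printing Implicit Defensive.
Import Order.TTheory GRing.Theory Num.Theory numFieldNormedType.Exports.
Local Open Scope classical_set_scope.
Local Open Scope ring_scope.

(** * Iterated integrals *)

Section joint_measurability.
Context {R : realType}.
Notation mu := (@lebesgue_measure R).

Lemma measurable_I01 : measurable (@I01 R : set (measurableTypeR R)).
Proof. exact: measurable_itv. Qed.

Lemma lebesgue_measure_I01 : mu I01 = 1%E.
Proof. by rewrite /I01 lebesgue_measure_itv/= lte_fin ltr01 sube0. Qed.

Lemma integral_I01_cst (c : R) : (\int[mu]_(x in I01) c%:E = c%:E)%E.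
Proof.
rewrite integral_cst; last exact: measurable_I01.
by transitivity (c%:E * 1)%E;
  [congr (_ * _)%E; exact: lebesgue_measure_I01|rewrite mule1].
Qed.

(** The class ranges over all parameter spaces at once, because the recursion in [jointly] changes
    the space at each step. *)
Definition class_of_maps (X : Type) :=
  forall d (T : measurableType d), (T -> X) -> Prop.

(** [jointly Q n F] says that [(t, y_1, ..., y_n) |-> F t [:: y_1; ...; y_n]]
    is in the class [Q]. Moving the observations one by one into the parameter
    space [T] avoids a dependent construction of the measurable space [R ^ n]. *)
Fixpoint jointly (X : Type) (Q : class_of_maps X) (n : nat) :
    forall d (T : measurableType d), (T -> seq R -> X) -> Prop :=
  match n with
  | 0 => fun d T F => Q d T (fun t => F t [::])
  | k.+1 => fun d T F =>
      @jointly X Q k _ (T * measurableTypeR R)%type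
        (fun ty s => F ty.1 (ty.2 :: s))
  end.

(** Pointwise operations of any arity pass through [jointly]. The type [I] indexes the arguments:
    [void] gives constants, [unit] unary, [bool] binary and [nat] countable operations. *)
Lemma jointly_map (I X Y : Type) (Q : class_of_maps X) (Q' : class_of_maps Y)
    (h : (I -> X) -> Y) :
  (forall d (T : measurableType d) (f : I -> T -> X),
    (forall i, Q d T (f i)) -> Q' d T (fun t => h (f^~ t))) ->
  forall n d (T : measurableType d) (F : I -> T -> seq R -> X),
  (forall i, jointly Q n (F i)) ->
  jointly Q' n (fun t s => h (fun i => F i t s)).
Proof.
move=> hQ; elim=> [|n IH] d T F FQ /=; first exact: (hQ d T (fun i t => F i t [::])).
exact: (IH _ _ (fun i (ty : T * measurableTypeR R) s => F i ty.1 (ty.2 :: s))).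
Qed.

Definition borel_pred : class_of_maps Prop := fun d T B => measurable B.
Definition borel_map : class_of_maps (\bar R) := fun d T f => measurable_fun setT f.

(** The set [P] is the accumulator of the induction: the constraint on the first observation is
    moved into it. *)
Lemma jointly_box n d (T : measurableType d) (P : set T) (A : nat -> set R) :
  measurable P -> (forall i, measurable (A i)) ->
  jointly borel_pred n (fun t s =>
    P t /\ size s = n /\ forall i, (i < n)%N -> A i (nth 0 s i)).
Proof.
elim: n d T P A => [|n IH] d T P A mP mA /=.
  rewrite /borel_pred (_ : (fun _ => _) = P)//; apply/funext => t; apply/propext.
  by split => [[]|].
have := IH _ (T * measurableTypeR R)%type (P `*` A 0%N) (fun i => A i.+1)
  (measurableX mP (mA 0%N)) (fun i => mA i.+1).
congr jointly; apply/funext => -[t y]; apply/funext => s /=; apply/propext.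
split=> [[[Pt Ay] [ss sA]]|[Pt [[ss] sA]]].
  by split=> //; rewrite ss; split=> // -[|i]//=; exact: sA.
by split; [split=> //; exact: (sA 0%N)|split=> // i; exact: (sA i.+1)].
Qed.

(** The sets with jointly measurable membership form a sigma-algebra that contains the boxes, and
    [<<s boxes n >>] is the smallest such. *)
Lemma jointly_test n (B : set (seq R)) d (T : measurableType d) :
  <<s boxes n >> B -> jointly borel_pred n (fun (_ : T) s => B s).
Proof.
move=> sB; apply: (sB [set B | jointly borel_pred n (fun (_ : T) s => B s)]); split.
  split.
  - apply: (@jointly_map void _ _ borel_pred borel_pred (fun _ => False) _ n d T
      (fun _ _ _ => False)) => // d' T' _ _.
    exact: measurable0.
  - move=> A jA /=; rewrite /setD /mkset.
    apply: (@jointly_map unit _ _ borel_pred borel_pred (fun X => setT tt /\ ~ X tt) _ n d T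
      (fun _ _ s => A s)) => // d' T' f mf.
    have := measurableC (mf tt); congr measurable.
    by apply/funext => t; apply/propext; split => // -[].
  - move=> F jF /=; rewrite /bigcup /mkset.
    apply: (@jointly_map nat _ _ borel_pred borel_pred (fun X => exists2 i, setT i & X i)
      _ n d T (fun i _ s => F i s)) => // d' T' f mf.
    by have := bigcupT_measurable f mf.
move=> _ [A [mA ->]] /=.
have := jointly_box n (@measurableT d T) mA; congr jointly.
by apply/funext => t; apply/funext => s; apply/propext; split => // -[].
Qed.

Lemma jointly_indic n (B : seq R -> bool) d (T : measurableType d) :
  <<s boxes n >> [set s | B s] ->
  jointly borel_map n (fun (_ : T) s => (B s)%:R%:E).
Proof.
move=> /(@jointly_test _ _ d T)/= jB.
have -> : (fun (_ : T) s => (B s)%:R%:E) =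
    (fun (_ : T) s => (`[< (B s : Prop) >])%:R%:E :> \bar R).
  by apply/funext => t; apply/funext => s; rewrite asboolb.
apply: (@jointly_map unit _ _ borel_pred borel_map (fun X => (`[< X tt >])%:R%:E) _ n d T
  (fun _ _ s => B s)) => // d' T' f mf.
rewrite /borel_map (_ : (fun t => _) = EFin \o (\1_(f tt) : T' -> R)).
  exact/measurable_EFinP/measurable_indic/(mf tt).
by apply/funext => t /=; rewrite indicE; congr (_%:R%:E); congr nat_of_bool.
Qed.

Lemma jointlyD n d (T : measurableType d) (F G : T -> seq R -> \bar R) :
  jointly borel_map n F -> jointly borel_map n G ->
  jointly borel_map n (fun t s => F t s + G t s)%E.
Proof.
move=> jF jG; apply: (@jointly_map bool _ _ borel_map borel_map
  (fun X => X true + X false)%E _ n d T (fun b => if b then F else G)).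
  by move=> d' T' f mf; exact: emeasurable_funD (mf true) (mf false).
by case.
Qed.

Lemma jointlyM n d (T : measurableType d) (F G : T -> seq R -> \bar R) :
  jointly borel_map n F -> jointly borel_map n G ->
  jointly borel_map n (fun t s => F t s * G t s)%E.
Proof.
move=> jF jG; apply: (@jointly_map bool _ _ borel_map borel_map
  (fun X => X true * X false)%E _ n d T (fun b => if b then F else G)).
  by move=> d' T' f mf; exact: emeasurable_funM (mf true) (mf false).
by case.
Qed.

Lemma jointly_cst n d (T : measurableType d) (c : \bar R) :
  jointly borel_map n (fun (_ : T) _ => c).
Proof.
by apply: (@jointly_map void _ _ borel_map borel_map (fun=> c) _ n d T (fun _ _ _ => c))
  => // d' T' f _; exact: measurable_cst.
Qed.

(** The factor [u] absorbs [g] of the first observation when that observation joins the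
    parameter. *)
Lemma jointly_prod n d (T : measurableType d) (u : T -> R) (g : R -> R) :
  measurable_fun setT u -> measurable_fun setT g ->
  jointly borel_map n (fun t s => (u t * \prod_(y <- s) g y)%:E).
Proof.
move=> mu_ mg; elim: n d T u mu_ => [|n IH] d T u mu_ /=.
  apply/measurable_EFinP; under eq_fun do rewrite big_nil mulr1.
  exact: mu_.
under eq_fun do under eq_fun do rewrite big_cons mulrA.
apply: (IH _ (T * measurableTypeR R)%type (fun ty => u ty.1 * g ty.2)).
by apply: measurable_funM; exact: measurableT_comp.
Qed.

Lemma iint_ge0 (g : R -> R) n (F : seq R -> \bar R) :
  (forall y, 0 <= g y) -> (forall s, 0 <= F s)%E -> (0 <= iint g n F)%E.
Proof.
move=> g0; elim: n F => [|n IH] F F0 //=.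
by apply: integral_ge0 => y _; rewrite mule_ge0 ?lee_fin// IH.
Qed.

(** After the first observation has joined the parameter, Tonelli's theorem integrates it out. The
    factor [\1_I01] turns the integral over the circle into one over the whole line. *)
Lemma iint_measurable (g : R -> R) n d (T : measurableType d)
    (F : T -> seq R -> \bar R) :
  measurable_fun setT g -> (forall y, 0 <= g y) -> (forall t s, 0 <= F t s)%E ->
  jointly borel_map n F ->
  measurable_fun setT (fun t => iint g n (F t)).
Proof.
move=> mg g0; elim: n d T F => [|n IH] d T F F0 //=.
move=> jF; have /= mI := IH _ (T * measurableTypeR R)%type
  (fun ty s => F ty.1 (ty.2 :: s)) (fun ty s => F0 ty.1 (ty.2 :: s)) jF.
pose f (ty : T * measurableTypeR R) :=
  ((g ty.2)%:E * iint g n (fun s => F ty.1 (ty.2 :: s)) * (\1_I01 ty.2)%:E)%E.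
rewrite (_ : (fun t => _) = fubini_F mu f); last first.
  by apply/funext => t; rewrite integral_mkcond epatch_indic.
apply: measurable_fun_fubini_tonelli_F.
  apply: emeasurable_funM; first apply: emeasurable_funM => //.
    by apply/measurable_EFinP; exact: measurableT_comp.
  apply/measurable_EFinP.
  exact: (measurableT_comp (measurable_indic measurable_I01)).
by move=> [t y]/=; rewrite !mule_ge0 ?lee_fin// iint_ge0.
Qed.

Lemma iint_section (g : R -> R) n d (T : measurableType d)
    (F : T -> seq R -> \bar R) t :
  measurable_fun setT g -> (forall y, 0 <= g y) -> (forall t s, 0 <= F t s)%E ->
  jointly borel_map n.+1 F ->
  measurable_fun (@I01 R) (fun y => iint g n (fun s => F t (y :: s))).
Proof.
move=> mg g0 F0 /= jF.
have /= mI := @iint_measurable g n _ (T * measurableTypeR R)%type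
  (fun ty s => F ty.1 (ty.2 :: s)) mg g0 (fun ty s => F0 ty.1 (ty.2 :: s)) jF.
apply: measurable_funTS.
exact: (measurableT_comp mI (pair1_measurable t)).
Qed.

Lemma iint_integrand (g : R -> R) n d (T : measurableType d)
    (F : T -> seq R -> \bar R) t :
  measurable_fun setT g -> (forall y, 0 <= g y) -> (forall t s, 0 <= F t s)%E ->
  jointly borel_map n.+1 F ->
  measurable_fun (@I01 R)
    (fun y => (g y)%:E * iint g n (fun s => F t (y :: s)))%E.
Proof.
move=> mg g0 F0 jF; apply: emeasurable_funM; last exact: iint_section.
by apply/measurable_EFinP; exact: measurable_funTS.
Qed.

Lemma iintD (g : R -> R) n d (T : measurableType d)
    (F G : T -> seq R -> \bar R) t :
  measurable_fun setT g -> (forall y, 0 <= g y) ->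
  (forall t s, 0 <= F t s)%E -> (forall t s, 0 <= G t s)%E ->
  jointly borel_map n F -> jointly borel_map n G ->
  iint g n (fun s => F t s + G t s)%E = (iint g n (F t) + iint g n (G t))%E.
Proof.
move=> mg g0; elim: n d T F G t => [|n IH] d T F G t F0 G0 jF jG //=.
rewrite -ge0_integralD //=.
- apply: eq_integral => y _.
  rewrite (IH _ (T * measurableTypeR R)%type (fun ty s => F ty.1 (ty.2 :: s))
    (fun ty s => G ty.1 (ty.2 :: s)) (t, y))//.
  by rewrite ge0_muleDr ?iint_ge0.
- exact: measurable_I01.
- by move=> y _; rewrite mule_ge0 ?lee_fin ?iint_ge0.
- exact: iint_integrand.
- by move=> y _; rewrite mule_ge0 ?lee_fin ?iint_ge0.
- exact: iint_integrand.
Qed.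

Lemma iintZ (g : R -> R) n d (T : measurableType d)
    (F : T -> seq R -> \bar R) t (c : R) :
  measurable_fun setT g -> (forall y, 0 <= g y) ->
  (forall t s, 0 <= F t s)%E -> 0 <= c -> jointly borel_map n F ->
  iint g n (fun s => c%:E * F t s)%E = (c%:E * iint g n (F t))%E.
Proof.
move=> mg g0 + c0; elim: n d T F t => [|n IH] d T F t F0 jF //=.
rewrite -ge0_integralZl_EFin //=.
- apply: eq_integral => y _; rewrite muleCA.
  rewrite (IH _ (T * measurableTypeR R)%type (fun ty s => F ty.1 (ty.2 :: s))
    (t, y))//.
- exact: measurable_I01.
- by move=> y _; rewrite mule_ge0 ?lee_fin ?iint_ge0.
- exact: iint_integrand.
Qed.

(** Measurability and value go through one induction, since additivity at each step needs the
    measurability of the remaining sum. *)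
Lemma iint_sum (g : R -> R) n d (T : measurableType d) (I : Type) (r : seq I)
    (F : I -> T -> seq R -> \bar R) t :
  measurable_fun setT g -> (forall y, 0 <= g y) ->
  (forall i t s, 0 <= F i t s)%E -> (forall i, jointly borel_map n (F i)) ->
  jointly borel_map n (fun t s => \sum_(i <- r) F i t s)%E /\
  iint g n (fun s => \sum_(i <- r) F i t s)%E = (\sum_(i <- r) iint g n (F i t))%E.
Proof.
move=> mg g0 F0 jF; elim: r => [|i r [IHj IH]].
  rewrite big_nil; under eq_fun do under eq_fun do rewrite big_nil.
  under [in X in _ /\ X]eq_fun do rewrite big_nil.
  split; first exact: jointly_cst.
  rewrite (_ : (fun=> 0%E) = (fun _ => 0%:E * 0)%E); last first.
    by apply/funext => s; rewrite mul0e.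
  by rewrite (@iintZ g n _ T (fun _ _ => 0%E)) ?mul0e//; exact: jointly_cst.
under eq_fun do under eq_fun do rewrite big_cons.
under [in X in _ /\ X]eq_fun do rewrite big_cons.
split; first exact: jointlyD.
rewrite big_cons -IH.
rewrite (@iintD g n _ T (F i) (fun t s => \sum_(j <- r) F j t s)%E t)//.
by move=> t' s; exact: sume_ge0.
Qed.

Lemma le_iint (g : R -> R) n d (T : measurableType d)
    (F G : T -> seq R -> \bar R) t :
  measurable_fun setT g -> (forall y, 0 <= g y) ->
  (forall t s, 0 <= F t s)%E -> (forall t s, F t s <= G t s)%E ->
  jointly borel_map n F -> jointly borel_map n G ->
  (iint g n (F t) <= iint g n (G t))%E.
Proof.
move=> mg g0; elim: n d T F G t => [|n IH] d T F G t F0 FG jF jG //=.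
have G0 t' s : (0 <= G t' s)%E by exact: le_trans (F0 t' s) (FG t' s).
apply: ge0_le_integral => //=.
- exact: measurable_I01.
- by move=> y _; rewrite mule_ge0 ?lee_fin ?iint_ge0.
- exact: iint_integrand.
- exact: iint_integrand.
- move=> y _; apply: lee_wpmul2l; first by rewrite lee_fin.
  exact: (IH _ (T * measurableTypeR R)%type (fun ty s => F ty.1 (ty.2 :: s))
    (fun ty s => G ty.1 (ty.2 :: s)) (t, y)).
Qed.

(** Change of measure: the product of [g] over the sample is the likelihood with respect to the
    uniform law, so all integrals can be taken under the null. *)
Lemma iint_weight (g : R -> R) n d (T : measurableType d)
    (F : T -> seq R -> \bar R) t :
  measurable_fun setT g -> (forall y, 0 <= g y) ->
  (forall t s, 0 <= F t s)%E -> jointly borel_map n F ->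
  iint g n (F t) =
  iint (fun=> 1) n (fun s => (\prod_(y <- s) g y)%:E * F t s)%E.
Proof.
move=> mg g0; elim: n d T F t => [|n IH] d T F t F0 jF /=.
  by rewrite big_nil mul1e.
have jp d' (T' : measurableType d') :
    jointly borel_map n (fun (_ : T') s => (\prod_(y <- s) g y)%:E).
  have := @jointly_prod n d' T' (fun=> 1) g (measurable_cst _) mg.
  by under eq_fun do under eq_fun do rewrite mul1r.
apply: eq_integral => y _; rewrite mul1e.
rewrite (IH _ (T * measurableTypeR R)%type (fun ty s => F ty.1 (ty.2 :: s)) (t, y))//.
transitivity (iint (fun=> 1) n (fun s =>
    (g y)%:E * ((\prod_(z <- s) g z)%:E * F t (y :: s)))%E); last first.
  by congr iint; apply/funext => s; rewrite big_cons EFinM muleA.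
rewrite (@iintZ _ n _ (T * measurableTypeR R)%type
  (fun ty s => (\prod_(y <- s) g y)%:E * F ty.1 (ty.2 :: s))%E (t, y))//.
- by move=> ty s; rewrite mule_ge0// lee_fin prodr_ge0.
- exact: jointlyM.
Qed.

Lemma iint1 (g : R -> R) n (m : R) :
  measurable_fun setT g -> (forall y, 0 <= g y) ->
  (\int[mu]_(x in I01) (g x)%:E = m%:E)%E ->
  iint g n (fun=> 1%E) = (m ^+ n)%:E.
Proof.
move=> mg g0 gm; elim: n => [|n IH] //=.
have m0 : 0 <= m by rewrite -lee_fin -gm integral_ge0// => y _; rewrite lee_fin.
rewrite IH; under eq_integral do rewrite muleC.
rewrite ge0_integralZl_EFin ?exprn_ge0// ?gm ?exprSr//.
- exact: measurable_I01.
- by move=> y _; rewrite lee_fin.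
- by apply/measurable_EFinP; exact: measurable_funTS.
Qed.

Lemma iint_prod (g : R -> R) n (m : R) :
  measurable_fun setT g -> (forall y, 0 <= g y) ->
  (\int[mu]_(x in I01) (g x)%:E = m%:E)%E ->
  iint (fun=> 1) n (fun s => (\prod_(y <- s) g y)%:E) = (m ^+ n)%:E.
Proof.
move=> mg g0 gm; rewrite -(@iint1 g n m)//.
rewrite (@iint_weight g n _ (measurableTypeR R) (fun _ _ => 1%E) 0)//.
  by congr iint; apply/funext => s; rewrite mule1.
exact: jointly_cst.
Qed.

End joint_measurability.

(** * Le Cam's bound for a finite mixture against the uniform law *)

Section mixture_bound.
Context {R : realType}.
Notation mu := (@lebesgue_measure R).
Variable n : nat.

(** The parameter space is a dummy: [jointly] asks for one although [F] depends on the sample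
    only. *)
Definition samplable (F : seq R -> \bar R) :=
  (forall s, 0 <= F s)%E /\
  jointly borel_map n (fun (_ : measurableTypeR R) s => F s).

Local Notation Eunif := (iint (fun=> 1) n).

Lemma samplableD F G : samplable F -> samplable G ->
  samplable (fun s => F s + G s)%E /\
  Eunif (fun s => F s + G s)%E = (Eunif F + Eunif G)%E.
Proof.
move=> [F0 jF] [G0 jG]; split; first by split=> [s|]; [exact: adde_ge0|exact: jointlyD].
exact: (@iintD _ _ n _ (measurableTypeR R) (fun _ => F) (fun _ => G) 0).
Qed.

Lemma samplableZ F (c : R) : 0 <= c -> samplable F ->
  samplable (fun s => c%:E * F s)%E /\
  Eunif (fun s => c%:E * F s)%E = (c%:E * Eunif F)%E.
Proof.
move=> c0 [F0 jF]; split; first split=> [s|].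
- by rewrite mule_ge0// lee_fin.
- exact: jointlyM (jointly_cst _ _ _) jF.
- exact: (@iintZ _ _ n _ (measurableTypeR R) (fun _ => F) 0).
Qed.

Lemma samplable_sum (I : finType) (F : I -> seq R -> \bar R) :
  (forall i, samplable (F i)) ->
  samplable (fun s => \sum_i F i s)%E /\
  Eunif (fun s => \sum_i F i s)%E = (\sum_i Eunif (F i))%E.
Proof.
move=> sF; have [] := @iint_sum _ (fun=> 1) n _ (measurableTypeR R) I
  (index_enum I) (fun i _ => F i) 0 (measurable_cst _) (fun _ => ler01)
  (fun i _ => (sF i).1) (fun i => (sF i).2).
by split=> //; split=> // s; apply: sume_ge0 => i _; exact: (sF i).1.
Qed.

Lemma samplable_prod (g : R -> R) (m : R) :
  measurable_fun setT g -> (forall y, 0 <= g y) ->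
  (\int[mu]_(x in I01) (g x)%:E = m%:E)%E ->
  samplable (fun s => (\prod_(y <- s) g y)%:E) /\
  Eunif (fun s => (\prod_(y <- s) g y)%:E) = (m ^+ n)%:E.
Proof.
move=> mg g0 gm; split; last exact: iint_prod.
split=> [s|]; first by rewrite lee_fin prodr_ge0.
have := @jointly_prod _ n _ (measurableTypeR R) (fun=> 1) g (measurable_cst _) mg.
by under eq_fun do under eq_fun do rewrite mul1r.
Qed.

Lemma samplable_cst (c : R) : 0 <= c ->
  samplable (fun _ => c%:E) /\ Eunif (fun _ => c%:E) = c%:E.
Proof.
move=> c0; have [s1 e1] := @samplable_prod (fun=> 1) 1 (measurable_cst _) (fun _ => ler01)
  (integral_I01_cst 1).
have [] := samplableZ c0 s1; rewrite e1 expr1n mule1.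
by under eq_fun do rewrite big1_eq mule1.
Qed.

Lemma samplable_test (D : seq R -> bool) b : is_test n D ->
  samplable (fun s => ((D s == b)%:R)%:E).
Proof.
move=> tD; split=> [s|]; first by rewrite lee_fin.
apply: jointly_indic; case: b.
  by rewrite (_ : mkset _ = [set s | D s])//; apply/funext => s /=; rewrite eqb_id.
rewrite (_ : mkset _ = setT `\` [set s | D s]); first exact: sigma_algebraCD.
apply/funext => s /=; apply/propext; rewrite eqbF_neg.
by split=> [/negP|[_ /negP]].
Qed.

(** Integrated against the uniform law, with [L] the likelihood ratio, this
    bounds the sum of both error probabilities from below in terms of
    [\int L ^ 2] only. It is the pointwise bound
    [min(1, L) >= 1 - eps / 2 - (L - 1) ^ 2 / (2 eps)], rearranged so that only
    nonnegative functions occur. *)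
Lemma likelihood_bound (L eps : R) (b : bool) : 0 < eps ->
  1 + eps^-1 * L <=
  b%:R + L * (~~ b)%:R + (eps / 2 + (2 * eps)^-1) + (2 * eps)^-1 * L ^+ 2.
Proof.
move=> e0.
have -> : (2 * eps)^-1 = eps^-1 / 2 by rewrite invfM mulrC.
have ee : eps * eps^-1 = 1 by rewrite divff ?gt_eqF.
have i0 : 0 < eps^-1 by rewrite invr_gt0.
set i := eps^-1 in ee i0 *.
case: b => /=; rewrite ?mulr0 ?mulr1 ?addr0 ?add0r.
  have : 0 <= i / 2 * (eps ^+ 2 + (L - 1) ^+ 2).
    by rewrite mulr_ge0 ?addr_ge0 ?sqr_ge0// divr_ge0// ltW.
  rewrite expr2 mulrDr (_ : i / 2 * (eps * eps) = eps * i * (eps / 2)); last by ring.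
  rewrite ee; nra.
have : 0 <= i / 2 * (L - 1 + eps) ^+ 2.
  by rewrite mulr_ge0 ?sqr_ge0// divr_ge0// ltW.
rewrite (_ : _ / 2 * _ = i / 2 * (L - 1) ^+ 2 + (eps * i) * (L - 1) +
  (eps * i) * (eps / 2)); last by field.
rewrite ee; nra.
Qed.

(** Under the uniform law the averaged likelihood ratio has mean 1, and its second moment is the
    average of [c i j ^+ n]. Integrating [likelihood_bound] gives the claim. *)
Lemma mixture_lower_bound (I : finType) (g : I -> R -> R) (c : I -> I -> R)
    (D : seq R -> bool) (eps : R) :
  (0 < #|I|)%N -> (forall i, measurable_fun setT (g i)) ->
  (forall i y, 0 <= g i y) ->
  (forall i, \int[mu]_(x in I01) (g i x)%:E = 1%:E)%E ->
  (forall i j, \int[mu]_(x in I01) (g i x * g j x)%:E = (c i j)%:E)%E ->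
  is_test n D -> 0 < eps ->
  ((1 - eps / 2 -
    (2 * eps)^-1 * ((#|I|%:R ^- 2) * (\sum_i \sum_j c i j ^+ n) - 1))%:E <=
   Eunif (fun s => ((D s == true)%:R)%:E) +
   \sum_i (#|I|%:R^-1)%:E * iint (g i) n (fun s => ((D s == false)%:R)%:E))%E.
Proof.
move=> I0 mg g0 g1 gc tD e0.
set w := #|I|%:R^-1.
have w0 : 0 <= w by rewrite invr_ge0.
have wI : w * #|I|%:R = 1 by rewrite mulVf// pnatr_eq0 -lt0n.
(* [W i] is the likelihood ratio of component [i]. The product of two of them is [W2 i j], itself a
   product over the sample, so that it integrates to [c i j ^+ n]. *)
pose W i (s : seq R) := \prod_(y <- s) g i y.
pose W2 i j (s : seq R) := \prod_(y <- s) (g i \* g j) y.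
have iD : forall b, samplable (fun s => ((D s == b)%:R)%:E).
  by move=> b; exact: samplable_test.
have sW i : samplable (fun s => (W i s)%:E) /\ Eunif (fun s => (W i s)%:E) = 1%:E.
  by have := samplable_prod (mg i) (g0 i) (g1 i); rewrite expr1n.
have sW2 i j := samplable_prod (measurable_funM (mg i) (mg j))
  (fun y => mulr_ge0 (g0 i y) (g0 j y)) (gc i j).
have sWD i : samplable (fun s => (W i s)%:E * ((D s == false)%:R)%:E)%E.
  have [[W0 jW] _] := sW i; have [D0 jD] := iD false; split=> [s|].
    by rewrite mule_ge0.
  exact: jointlyM.
have eWD i : iint (g i) n (fun s => ((D s == false)%:R)%:E) =
    Eunif (fun s => (W i s)%:E * ((D s == false)%:R)%:E)%E.
  have [D0 jD] := iD false.
  exact: (@iint_weight _ (g i) n _ (measurableTypeR R)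
    (fun _ s => ((D s == false)%:R)%:E) 0).
under [X in (_ <= _ + X)%E]eq_bigr do rewrite eWD.
have sA1 i := samplableZ w0 (sW i).1.
have [sA2 eA2] := samplable_sum (fun i => (sA1 i).1).
have ei0 : 0 <= eps^-1 by rewrite invr_ge0 ltW.
have [sA3 eA3] := samplableZ ei0 sA2.
have [s1 e1] := samplable_cst ler01.
have [sA eA] := samplableD s1 sA3.
have sB1 i := samplableZ w0 (sWD i).
have [sB2 eB2] := samplable_sum (fun i => (sB1 i).1).
have [sB3 eB3] := samplableD (iD true) sB2.
have k0 : 0 <= eps / 2 + (2 * eps)^-1.
  by rewrite addr_ge0 ?invr_ge0 ?divr_ge0 ?mulr_ge0// ltW.
have [s2 e2] := samplable_cst k0.
have [sB4 eB4] := samplableD sB3 s2.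
have sB5 i := samplable_sum (fun j => (sW2 i j).1).
have [sB6 eB6] := samplable_sum (fun i => (sB5 i).1).
have h0 : 0 <= (2 * eps)^-1 * w ^+ 2.
  by rewrite mulr_ge0 ?exprn_ge0// invr_ge0 mulr_ge0// ltW.
have [sB7 eB7] := samplableZ h0 sB6.
have [sB eB] := samplableD sB4 sB7.
have eL : (\sum_i Eunif (fun s => w%:E * (W i s)%:E) = 1%:E)%E.
  under eq_bigr => i _ do rewrite (sA1 i).2 (sW i).2 mule1.
  by rewrite sumEFin sumr_const -[w *+ _]mulr_natr wI.
have eQ : (\sum_(i : I) Eunif (fun s => \sum_(j : I) (W2 i j s)%:E) =
    (\sum_i \sum_j c i j ^+ n)%:E)%E.
  rewrite -sumEFin; apply: eq_bigr => i _; rewrite (sB5 i).2 -sumEFin.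
  by apply: eq_bigr => j _; rewrite (sW2 i j).2.
have := @le_iint _ (fun=> 1) n _ (measurableTypeR R) _ _ 0 (measurable_cst _)
  (fun _ => ler01) (fun _ => sA.1) _ sA.2 sB.2.
rewrite eA eA3 eA2 eL eB eB4 eB3 eB2 eB7 eB6 eQ e1 e2.
under [X in _ -> (_ <= _ + X)%E]eq_bigr => i _ do rewrite -(sB1 i).2.
set V := (Eunif (fun s => ((D s == true)%:R)%:E) + _)%E; set Q := \sum_i _ => AB.
have {}AB : (1%:E + (eps^-1)%:E * 1%:E <= V + (eps / 2 + (2 * eps)^-1)%:E +
    ((2 * eps)^-1 * w ^+ 2)%:E * Q%:E)%E.
  apply: AB => _ s.
  pose L := w * \sum_i W i s.
  have wL : (\sum_i w%:E * (W i s)%:E = L%:E)%E.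
    by under eq_bigr do rewrite -EFinM; rewrite sumEFin -mulr_sumr.
  have wD : (\sum_i w%:E * ((W i s)%:E * ((D s == false)%:R)%:E) =
      (L * (D s == false)%:R)%:E)%E.
    under eq_bigr do rewrite muleA -!EFinM.
    by rewrite sumEFin -mulr_suml -mulr_sumr.
  have wQ : (\sum_i \sum_j (W2 i j s)%:E = ((\sum_i W i s) ^+ 2)%:E)%E.
    rewrite expr2 big_distrlr/= -sumEFin; apply: eq_bigr => i _.
    rewrite -sumEFin; apply: eq_bigr => j _.
    by rewrite /W2 /W big_split.
  rewrite wL wD wQ -!EFinM -!EFinD lee_fin.
  have := likelihood_bound L (D s) e0.
  by rewrite /L exprMn eqb_id eqbF_neg !mulrA.
rewrite -!EFinM -!EFinD mulr1 in AB.
have w2 : w ^+ 2 = #|I|%:R ^- 2 by rewrite exprVn.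
(* For finite [V] the integrated inequality [AB] is a linear one between reals. *)
rewrite -w2; case: V AB => [v| |]//; rewrite ?leey// -?EFinD ?lee_fin.
have i2 : (2 * eps)^-1 * 2 = eps^-1 by rewrite invfM mulrAC mulVf ?mul1r.
by move: ((2 * eps)^-1) i2 => z <-; lra.
Qed.

End mixture_bound.

(** * Fourier coefficients on the circle *)

Section fourier.
Context {R : realType}.
Notation mu := (@lebesgue_measure R).
Implicit Types (h : R -> R) (m : int).

Definition L1 h := mu.-integrable (@I01 R) (EFin \o h).

Lemma L1_continuous h : continuous h -> L1 h.
Proof.
move=> ch; have : mu.-integrable `[0, 1] (EFin \o h).
  apply: continuous_compact_integrable; first exact: segment_compact.
  exact: continuous_subspaceT.
apply: integrableS => //; first exact: measurable_I01.
by apply: subset_itvl; rewrite bnd_simp.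
Qed.

Lemma LintD h1 h2 : L1 h1 -> L1 h2 ->
  Lint (fun x => h1 x + h2 x) = Lint h1 + Lint h2.
Proof. by move=> i1 i2; apply: RintegralD => //; exact: measurable_I01. Qed.

Lemma LintZ c h : L1 h -> Lint (fun x => c * h x) = c * Lint h.
Proof. by move=> ih; apply: RintegralZl => //; exact: measurable_I01. Qed.

Lemma L1D h1 h2 : L1 h1 -> L1 h2 -> L1 (fun x => h1 x + h2 x).
Proof. by move=> i1 i2; exact: (integrableD measurable_I01 i1 i2). Qed.

Lemma L1Z c h : L1 h -> L1 (fun x => c * h x).
Proof. by move=> ih; exact: (integrableZl measurable_I01 c ih). Qed.

Lemma Lint_cst (c : R) : Lint (fun=> c) = c.
Proof. by rewrite /Lint /Rintegral integral_I01_cst. Qed.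

Lemma L1_sum (I : Type) (r : seq I) (F : I -> R -> R) :
  (forall i, L1 (F i)) ->
  L1 (fun x => \sum_(i <- r) F i x) /\
  Lint (fun x => \sum_(i <- r) F i x) = \sum_(i <- r) Lint (F i).
Proof.
move=> iF; elim: r => [|i r [IHi IH]].
  rewrite big_nil; under eq_fun do rewrite big_nil.
  by split; [exact/L1_continuous/cst_continuous|exact: Lint_cst].
have -> : (fun x => \sum_(j <- i :: r) F j x) =
    (fun x => F i x + \sum_(j <- r) F j x) by apply/funext => x; rewrite big_cons.
by rewrite big_cons -IH -LintD//; split=> //; exact: L1D.
Qed.

Lemma eq_Lint h1 h2 : {in I01, h1 =1 h2} -> Lint h1 = Lint h2.
Proof. by move=> h12; apply: eq_Rintegral. Qed.

Lemma cos_intD m (x : R) : cos (x + 2 * pi * m%:~R) = cos x.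
Proof.
have nat_case n y : cos (y + 2 * pi * n%:R) = cos y :> R.
  by rewrite mulr_natr mulr_natl (periodicn (@cosD2pi R)).
case: m => n; first exact: nat_case.
rewrite NegzE mulrNz mulrN -[in RHS](subrK (2 * pi * n.+1%:R) x).
by rewrite nat_case.
Qed.

Lemma sin_intD m (x : R) : sin (x + 2 * pi * m%:~R) = sin x.
Proof.
by rewrite -[LHS]cosBpihalf addrAC cos_intD cosBpihalf.
Qed.

Definition cosf m (x : R) := cos (2 * pi * m%:~R * x).
Definition sinf m (x : R) := sin (2 * pi * m%:~R * x).

Lemma is_derive_sin_scale (k x : R) : is_derive x 1 (fun y => sin (k * y)) (k * cos (k * x)).
Proof.
have dk : is_derive x 1 (fun y : R => k * y) k.
  by apply: is_derive_eq; rewrite /GRing.scale/= mulr1.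
have := @is_derive1_comp R (@sin R) (fun y => k * y) x _ _ (is_derive_sin _) dk.
by move/is_derive_eq; apply; rewrite mulrC.
Qed.

Lemma is_derive_cos_scale (k x : R) : is_derive x 1 (fun y => cos (k * y)) (- k * sin (k * x)).
Proof.
have dk : is_derive x 1 (fun y : R => k * y) k.
  by apply: is_derive_eq; rewrite /GRing.scale/= mulr1.
have := @is_derive1_comp R (@cos R) (fun y => k * y) x _ _ (is_derive_cos _) dk.
by move/is_derive_eq; apply; rewrite mulrC mulNr mulrN.
Qed.

Lemma is_derive_continuous (f df : R -> R) :
  (forall x : R, is_derive x 1 f (df x)) -> continuous f.
Proof.
move=> dF x; apply: differentiable_continuous; apply/derivable1_diffP.
by have [] := dF x.
Qed.

Lemma continuous_cosf m : continuous (cosf m).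
Proof. exact: is_derive_continuous (is_derive_cos_scale _). Qed.

Lemma continuous_sinf m : continuous (sinf m).
Proof. exact: is_derive_continuous (is_derive_sin_scale _). Qed.

Lemma Lint_derivative (F f : R -> R) : continuous f ->
  (forall x : R, is_derive x 1 F (f x)) -> Lint f = F 1 - F 0.
Proof.
(* Adding the endpoint 1 does not change the integral and makes the fundamental theorem of calculus
   applicable. *)
move=> cf dF; rewrite /Lint /Rintegral /I01 integral_itv_bndo_bndc; last first.
  by apply/measurable_EFinP; apply: measurable_funTS; exact: continuous_measurable_fun.
have cF := is_derive_continuous dF.
rewrite (@continuous_FTC2 _ f F)// ?ltr01//.
- exact: continuous_subspaceT.
- split=> [x _| |]; first by have [] := dF x.
    exact/cvg_at_right_filter/cF.
  exact/cvg_at_left_filter/cF.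
- by move=> x _; rewrite derive1E; have [_] := dF x.
Qed.

Lemma two_pi_int_neq0 m : m != 0 -> 2 * pi * m%:~R != 0 :> R.
Proof. by move=> m0; rewrite mulf_neq0 ?intr_eq0// mulf_neq0// gt_eqF// pi_gt0. Qed.

(** For [m != 0] a primitive is periodic with period 1, so its values at 0 and 1 agree. *)
Lemma Lint_cosf m : Lint (cosf m) = (m == 0)%:R.
Proof.
have [->|m0] := eqVneq.
  rewrite -[RHS]Lint_cst; apply: eq_Lint => x _.
  by rewrite /cosf mulr0 mul0r cos0.
have k0 := two_pi_int_neq0 m0; set k := 2 * pi * _ in k0.
have dF (x : R) : is_derive x 1 (fun x => k^-1 * sin (k * x)) (cosf m x).
  have dS := is_derive_sin_scale k x.
  by apply: is_derive_eq; rewrite /GRing.scale/= mulKf.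
rewrite (Lint_derivative (@continuous_cosf m) dF).
by rewrite mulr1 mulr0 sin0 -[k]add0r sin_intD sin0 !mulr0 subr0.
Qed.

Lemma Lint_sinf m : Lint (sinf m) = 0.
Proof.
have [->|m0] := eqVneq m 0.
  rewrite -[RHS]Lint_cst; apply: eq_Lint => x _.
  by rewrite /sinf mulr0 mul0r sin0.
have k0 := two_pi_int_neq0 m0; set k := 2 * pi * _ in k0.
have dF (x : R) : is_derive x 1 (fun x => - k^-1 * cos (k * x)) (sinf m x).
  have dS := is_derive_cos_scale k x.
  by apply: is_derive_eq; rewrite /GRing.scale/= mulrA mulrNN mulVf ?mul1r.
rewrite (Lint_derivative (@continuous_sinf m) dF).
by rewrite mulr1 mulr0 cos0 -[k]add0r cos_intD cos0 subrr.
Qed.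

Let freqD m1 m2 (x : R) :
  2 * pi * (m1 + m2)%:~R * x = 2 * pi * m1%:~R * x + 2 * pi * m2%:~R * x.
Proof. by rewrite intrD mulrDr mulrDl. Qed.

Let freqB m1 m2 (x : R) :
  2 * pi * (m1 - m2)%:~R * x = 2 * pi * m1%:~R * x - 2 * pi * m2%:~R * x.
Proof. by rewrite intrB mulrBr mulrBl. Qed.

Lemma cosfM m1 m2 x :
  cosf m1 x * cosf m2 x = 2^-1 * cosf (m1 - m2) x + 2^-1 * cosf (m1 + m2) x.
Proof.
by rewrite /cosf freqB freqD cosB cosD; field.
Qed.

Lemma sinfM m1 m2 x :
  sinf m1 x * sinf m2 x = 2^-1 * cosf (m1 - m2) x + (- 2^-1) * cosf (m1 + m2) x.
Proof.
by rewrite /cosf /sinf freqB freqD cosB cosD; field.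
Qed.

Lemma cossinfM m1 m2 x :
  cosf m1 x * sinf m2 x = 2^-1 * sinf (m1 + m2) x + (- 2^-1) * sinf (m1 - m2) x.
Proof.
by rewrite /cosf /sinf freqB freqD sinB sinD; field.
Qed.

Let L1_cosf m := L1_continuous (@continuous_cosf m).
Let L1_sinf m := L1_continuous (@continuous_sinf m).

(** The frequencies are successors, so their sum is nonzero and only the difference term of the
    product formula can survive. *)
Lemma Lint_coscos (i j : nat) :
  Lint (fun x => cosf i.+1 x * cosf j.+1 x) = 2^-1 * (i == j)%:R.
Proof.
under eq_Lint do rewrite cosfM.
rewrite LintD ?LintZ ?Lint_cosf//; try exact: L1Z.
by rewrite subr_eq0 eqz_nat eqSS mulr0 addr0.
Qed.

Lemma Lint_sinsin (i j : nat) :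
  Lint (fun x => sinf i.+1 x * sinf j.+1 x) = 2^-1 * (i == j)%:R.
Proof.
under eq_Lint do rewrite sinfM.
rewrite LintD ?LintZ ?Lint_cosf//; try exact: L1Z.
by rewrite subr_eq0 eqz_nat eqSS mulr0 addr0.
Qed.

Lemma Lint_cossin (i j : nat) : Lint (fun x => cosf i.+1 x * sinf j.+1 x) = 0.
Proof.
under eq_Lint do rewrite cossinfM.
rewrite LintD ?LintZ ?Lint_sinf//; try exact: L1Z.
by rewrite !mulr0 addr0.
Qed.

End fourier.

(** * Orthogonality relations for real trigonometric polynomials *)

Section trigonometric_polynomials.
Context {R : realType}.
Notation mu := (@lebesgue_measure R).
Implicit Types (a b : nat -> R) (J : nat) (m : nat).

(** The shift to frequency [j.+1] excludes a constant term. Sines are included because convolution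
    with [phi] creates them out of cosines. *)
Definition trigp J a b (x : R) : R :=
  \sum_(j < J) (a j * cosf j.+1 x + b j * sinf j.+1 x).

Lemma continuous_prod (f g : R -> R) : continuous f -> continuous g ->
  continuous (fun x => f x * g x).
Proof. by move=> cf cg x; apply: cvgM; [exact: cf|exact: cg]. Qed.

Lemma continuous_plus (f g : R -> R) : continuous f -> continuous g ->
  continuous (fun x => f x + g x).
Proof. by move=> cf cg x; apply: cvgD; [exact: cf|exact: cg]. Qed.

Lemma continuous_harmonic (u v : R) (m : int) :
  continuous (fun x => u * cosf m x + v * sinf m x).
Proof.
apply: continuous_plus; apply: continuous_prod; try exact: cst_continuous.
  exact: continuous_cosf.
exact: continuous_sinf.
Qed.

Lemma continuous_trigp J a b : continuous (trigp J a b).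
Proof.
rewrite /trigp; elim: (index_enum 'I_J) => [|j r IH].
  by under eq_fun do rewrite big_nil; exact: cst_continuous.
under eq_fun do rewrite big_cons; apply: continuous_plus => //.
exact: continuous_harmonic.
Qed.

Lemma integral_L1 (h : R -> R) : L1 h ->
  (\int[mu]_(x in I01) (h x)%:E)%E = (Lint h)%:E.
Proof.
move=> ih; rewrite /Lint /Rintegral fineK//.
exact: (integrable_fin_num measurable_I01 ih).
Qed.

Lemma Lint_trigp J a b : Lint (trigp J a b) = 0.
Proof.
have ic j := L1_continuous (@continuous_cosf R j).
have is_ j := L1_continuous (@continuous_sinf R j).
have [|_ ->] := @L1_sum R _ (index_enum 'I_J)
  (fun j x => a j * cosf j.+1 x + b j * sinf j.+1 x).
  by move=> j; apply: L1D; exact: L1Z.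
rewrite big1// => j _; rewrite LintD ?LintZ//; try exact: L1Z.
by rewrite Lint_cosf Lint_sinf !mulr0 addr0.
Qed.

Lemma sum_kronecker J a m :
  \sum_(j < J) a j * (2^-1 * (j == m :> nat)%:R) = if (m < J)%N then a m / 2 else 0.
Proof.
case: ifPn => [mJ|].
  rewrite (bigD1 (Ordinal mJ))//= eqxx mulr1 big1 ?addr0// => j.
  by rewrite -val_eqE/= => /negbTE ->; rewrite !mulr0.
rewrite -leqNgt => Jm; rewrite big1// => j _.
by rewrite ltn_eqF ?mulr0// (leq_trans (ltn_ord j)).
Qed.

Lemma Lint_trigp_cos J a b m :
  Lint (fun x => trigp J a b x * cosf m.+1 x) = if (m < J)%N then a m / 2 else 0.
Proof.
have ic i := @continuous_cosf R i.
have is_ i := @continuous_sinf R i.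
rewrite -sum_kronecker.
under eq_Lint do rewrite mulr_suml.
have [|_ ->] := @L1_sum R _ (index_enum 'I_J)
  (fun j x => (a j * cosf j.+1 x + b j * sinf j.+1 x) * cosf m.+1 x).
  move=> j; apply: L1_continuous => x; apply: cvgM; last exact: ic.
  exact: continuous_harmonic.
apply: eq_bigr => j _; rewrite -Lint_coscos -LintZ; last first.
  by apply: L1_continuous; exact: continuous_prod.
(* The sine term, whose integral is zero, is added to recover the full summand. *)
have -> : Lint (fun x => a j * (cosf j.+1 x * cosf m.+1 x)) =
    Lint (fun x => a j * (cosf j.+1 x * cosf m.+1 x)) +
    Lint (fun x => b j * (cosf m.+1 x * sinf j.+1 x)).
  rewrite [in X in _ + X]LintZ ?Lint_cossin ?mulr0 ?addr0//.
  by apply: L1_continuous; exact: continuous_prod.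
rewrite -LintD; last 2 first.
- by apply/L1Z/L1_continuous; exact: continuous_prod.
- by apply/L1Z/L1_continuous; exact: continuous_prod.
by apply: eq_Lint => x _; ring.
Qed.

Lemma Lint_trigp_sin J a b m :
  Lint (fun x => trigp J a b x * sinf m.+1 x) = if (m < J)%N then b m / 2 else 0.
Proof.
have ic i := @continuous_cosf R i.
have is_ i := @continuous_sinf R i.
rewrite -sum_kronecker.
under eq_Lint do rewrite mulr_suml.
have [|_ ->] := @L1_sum R _ (index_enum 'I_J)
  (fun j x => (a j * cosf j.+1 x + b j * sinf j.+1 x) * sinf m.+1 x).
  move=> j; apply: L1_continuous => x; apply: cvgM; last exact: is_.
  exact: continuous_harmonic.
apply: eq_bigr => j _; rewrite -Lint_sinsin -LintZ; last first.
  by apply: L1_continuous; exact: continuous_prod.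
have -> : Lint (fun x => b j * (sinf j.+1 x * sinf m.+1 x)) =
    Lint (fun x => a j * (cosf j.+1 x * sinf m.+1 x)) +
    Lint (fun x => b j * (sinf j.+1 x * sinf m.+1 x)).
  rewrite [in X in X + _]LintZ ?Lint_cossin ?mulr0 ?add0r//.
  by apply: L1_continuous; exact: continuous_prod.
rewrite -LintD; last 2 first.
- by apply/L1Z/L1_continuous; exact: continuous_prod.
- by apply/L1Z/L1_continuous; exact: continuous_prod.
by apply: eq_Lint => x _; ring.
Qed.

(** Parseval's identity: the second factor is expanded, and its harmonics read off the coefficients
    of the first. *)
Lemma Lint_trigpM J a b a' b' :
  Lint (fun x => trigp J a b x * trigp J a' b' x) =
  \sum_(j < J) (a j * a' j + b j * b' j) / 2.
Proof.
have ic i := @continuous_cosf R i.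
have is_ i := @continuous_sinf R i.
have ct := @continuous_trigp J a b.
under eq_Lint do rewrite mulr_sumr.
have [|_ ->] := @L1_sum R _ (index_enum 'I_J)
  (fun j x => trigp J a b x * (a' j * cosf j.+1 x + b' j * sinf j.+1 x)).
  move=> j; apply: L1_continuous => x; apply: cvgM; first exact: ct.
  exact: continuous_harmonic.
apply: eq_bigr => j _.
transitivity (Lint (fun x => a' j * (trigp J a b x * cosf j.+1 x) +
    b' j * (trigp J a b x * sinf j.+1 x))).
  by apply: eq_Lint => x _; ring.
rewrite LintD; last 2 first.
- by apply/L1Z/L1_continuous; exact: continuous_prod.
- by apply/L1Z/L1_continuous; exact: continuous_prod.
rewrite !LintZ; last 2 first.
- by apply/L1_continuous; exact: continuous_prod.
- by apply/L1_continuous; exact: continuous_prod.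
rewrite Lint_trigp_cos Lint_trigp_sin ltn_ord; ring.
Qed.

Lemma Lint_1trigpM J a b a' b' :
  Lint (fun x => (1 + trigp J a b x) * (1 + trigp J a' b' x)) =
  1 + \sum_(j < J) (a j * a' j + b j * b' j) / 2.
Proof.
have ct a0 b0 := @continuous_trigp J a0 b0.
have i1 : L1 (fun=> 1 : R) by exact/L1_continuous/cst_continuous.
rewrite -Lint_trigpM.
transitivity (Lint (fun x => 1 + (trigp J a b x + (trigp J a' b' x +
    trigp J a b x * trigp J a' b' x)))).
  by apply: eq_Lint => x _; ring.
have i2 a0 b0 : L1 (trigp J a0 b0) by exact/L1_continuous/ct.
have i3 : L1 (fun x => trigp J a b x * trigp J a' b' x).
  by apply: L1_continuous; exact: continuous_prod.
rewrite LintD//; last by apply: L1D => //; exact: L1D.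
rewrite LintD//; last exact: L1D.
by rewrite LintD// !Lint_trigp !add0r Lint_cst.
Qed.

Lemma Lint_1trigp J a b : Lint (fun x => 1 + trigp J a b x) = 1.
Proof.
rewrite LintD ?Lint_trigp ?Lint_cst ?addr0//; apply: L1_continuous.
  exact: cst_continuous.
exact: continuous_trigp.
Qed.

End trigonometric_polynomials.

(** * Perturbed densities: norm, Fourier coefficients and membership in the ellipsoid *)

Section alternatives.
Context {R : realType}.
Notation mu := (@lebesgue_measure R).
Variables (J : nat) (a : nat -> R).

Definition cosine_density (x : R) : R := 1 + trigp J a (fun=> 0) x.

Local Notation f := cosine_density.

Lemma continuous_cosine_density : continuous f.
Proof. by apply: continuous_plus; [exact: cst_continuous|exact: continuous_trigp]. Qed.

Lemma cosine_densityE x : f x = 1 + \sum_(j < J) a j * cosf j.+1 x.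
Proof. by congr (_ + _); apply: eq_bigr => j _; rewrite mul0r addr0. Qed.

Lemma fcirc_I01 x : I01 x -> fcirc x = 1 :> R.
Proof. by rewrite /I01/= in_itv/= /fcirc => ->. Qed.

Lemma frac_I01 (y : R) : I01 (Defs.frac y).
Proof. by rewrite /I01/= in_itv/= /Defs.frac subr_ge0 floor_le/= ltrBlDl -[1]/(1%:~R) -intrD floorD1_gt. Qed.

Lemma cosine_density_frac y : f (Defs.frac y) = f y.
Proof.
rewrite !cosine_densityE; congr (_ + _); apply: eq_bigr => j _; congr (_ * _).
rewrite /cosf /Defs.frac -[LHS](cos_intD (j.+1%:Z * Num.floor y)) intrM.
by congr cos; ring.
Qed.

Lemma cosine_density_ge0 : \sum_(j < J) `|a j| <= 1 -> forall x, 0 <= f x.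
Proof.
move=> a1 x; rewrite cosine_densityE -lerBlDl sub0r lerNl -sumrN.
apply: le_trans a1; apply: ler_sum => j _.
by rewrite (le_trans (ler_norm _))// normrN normrM ler_piMr// cos_max.
Qed.

(** On the line [fcirc] jumps at 0 and 1, so differences with it are only known to agree with a
    continuous function on [I01]. *)
Lemma inL2_continuous_I01 (h g : R -> R) : continuous g -> {in I01, g =1 h} ->
  inL2 h.
Proof.
move=> cg gh; split.
  have mg : measurable_fun I01 g.
    by apply: measurable_funTS; exact: continuous_measurable_fun.
  exact: (@eq_measurable_fun _ _ (measurableTypeR R) (measurableTypeR R) I01 g h gh).
have ig : L1 (fun x => g x * g x) by apply: L1_continuous; exact: continuous_prod.
have -> : (\int[mu]_(x in I01) ((h x) ^+ 2)%:E = \int[mu]_(x in I01) (g x * g x)%:E)%E.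
  by apply: eq_integral => x xI; rewrite expr2 gh.
by rewrite integral_L1// ltry.
Qed.

Lemma density_cosine_density : \sum_(j < J) `|a j| <= 1 -> density f.
Proof.
move=> a1; split; first exact: (inL2_continuous_I01 continuous_cosine_density).
by split; [move=> x _; exact: cosine_density_ge0|exact: Lint_1trigp].
Qed.

Lemma cosine_density_centered : {in I01, trigp J a (fun=> 0) =1 (fun x => f x - fcirc x)}.
Proof. by move=> x /set_mem xI; rewrite fcirc_I01// addrC addKr. Qed.

Lemma L2norm_cosine_density :
  L2norm (fun x => f x - fcirc x) = Num.sqrt (\sum_(j < J) a j ^+ 2 / 2).
Proof.
rewrite /L2norm; congr Num.sqrt.
transitivity (Lint (fun x => trigp J a (fun=> 0) x * trigp J a (fun=> 0) x)).
  by apply: eq_Lint => x xI; rewrite -cosine_density_centered// expr2.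
by rewrite Lint_trigpM; apply: eq_bigr => j _; rewrite mulr0 addr0 expr2.
Qed.

Lemma fabs2_cosine_density (m : nat) :
  fabs2 (fun x => f x - fcirc x) m.+1 = if (m < J)%N then a m ^+ 2 / 4 else 0.
Proof.
rewrite /fabs2 /fre /fim.
have -> : Lint (fun x => (f x - fcirc x) * cos (2 * pi * m.+1%:~R * x)) =
    Lint (fun x => trigp J a (fun=> 0) x * cosf m.+1 x).
  by apply: eq_Lint => x xI; rewrite -cosine_density_centered.
have -> : Lint (fun x => (f x - fcirc x) * sin (2 * pi * m.+1%:~R * x)) =
    Lint (fun x => trigp J a (fun=> 0) x * sinf m.+1 x).
  by apply: eq_Lint => x xI; rewrite -cosine_density_centered.
rewrite Lint_trigp_cos Lint_trigp_sin; case: ifP => _; first by field.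
by rewrite !expr0n addr0.
Qed.

Lemma ellipsoid_cosine_density (w : nat -> R) (r : R) :
  (forall j, (j < J)%N -> 0 < w j.+1) ->
  \sum_(j < J) w j.+1 ^- 2 * (a j ^+ 2 / 4) <= r ^+ 2 / 2 ->
  ellipsoid w r (fun x => f x - fcirc x).
Proof.
move=> w0 wr; split.
  apply: (inL2_continuous_I01 (@continuous_trigp R J a (fun=> 0))).
  exact: cosine_density_centered.
have fabs2_ge0 j : 0 <= fabs2 (fun x => f x - fcirc x) j.
  by rewrite /fabs2 addr_ge0 ?sqr_ge0.
rewrite (nneseries_split 1 J) => [|k _]; last first.
  by rewrite lee_fin mulr_ge0// invr_ge0 sqr_ge0.
(* Frequencies above [J] have zero Fourier coefficient, so the tail of the series vanishes. *)
rewrite [X in (_ + X)%E]eseries0 ?adde0 => [|[|i]//]; last first.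
  rewrite add1n ltnS => Ji _.
  by rewrite fabs2_cosine_density ltnNge Ji/= mulr0.
rewrite sumEFin -EFinM lee_fin big_add1 add1n/= big_mkord.
under eq_bigr do rewrite fabs2_cosine_density ltn_ord.
by rewrite mulrC -ler_pdivlMr.
Qed.

(** * Convolution with the error density *)

Section convolution.
Variable phi : R -> R.
Hypothesis phi_density : density phi.

(** An infinite integral would be read as the default value 0 by [Lint], so [Lint phi = 1] forces
    the integral to be finite. *)
Lemma L1_density : L1 phi.
Proof.
have [[mphi _] [phi0 phi1]] := phi_density.
apply/integrableP; split; first exact/measurable_EFinP.
have -> : (\int[mu]_(x in I01) `|(EFin \o phi) x| = \int[mu]_(x in I01) (phi x)%:E)%E.
  by apply: eq_integral => x /set_mem xI; rewrite /= ger0_norm// phi0.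
move: phi1; rewrite /Lint /Rintegral.
have : (0 <= \int[mu]_(x in I01) (phi x)%:E)%E.
  by apply: integral_ge0 => x xI; rewrite lee_fin phi0.
case: (\int[mu]_(x in I01) (phi x)%:E)%E => [r _ _|_ /eqP|//]; first exact: ltry.
by rewrite eq_sym oner_eq0.
Qed.

Lemma L1_densityM (g : R -> R) : continuous g -> (forall x, `|g x| <= 1) ->
  L1 (fun x => phi x * g x).
Proof.
move=> cg g1; have mg : measurable_fun I01 g.
  by apply: measurable_funTS; exact: continuous_measurable_fun.
apply: (integrableMl measurable_I01 L1_density mg).
exists 1; split => // M M1 x _ /=.
by rewrite (le_trans (g1 x))// ltW.
Qed.

Lemma conv_fcirc : Defs.conv fcirc phi = (fun=> 1).
Proof.
apply/funext => y; have [_ [_ <-]] := phi_density.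
by apply: eq_Lint => s _; rewrite fcirc_I01 ?mul1r//; exact: frac_I01.
Qed.

(** The addition formula separates [y] from [s] in each cosine, which multiplies the coefficients by
    those of [phi]; the imaginary parts of the latter produce the sines. *)
Lemma conv_cosine_density :
  Defs.conv f phi = fun y => 1 + trigp J (fun j => a j * fre phi j.+1)
                                    (fun j => a j * fim phi j.+1) y.
Proof.
apply/funext => y; have [_ [_ phi1]] := phi_density.
have ipc j : L1 (fun s => phi s * cosf j s).
  by apply: L1_densityM; [exact: continuous_cosf|move=> x; exact: cos_max].
have ips j : L1 (fun s => phi s * sinf j s).
  by apply: L1_densityM; [exact: continuous_sinf|move=> x; exact: sin_max].
pose F (j : 'I_J) s := (a j * cosf j.+1 y) * (phi s * cosf j.+1 s) +
  (a j * sinf j.+1 y) * (phi s * sinf j.+1 s).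
have iF j : L1 (F j) by apply: L1D; exact: L1Z.
have [iS LS] := L1_sum (index_enum 'I_J) iF.
transitivity (Lint (fun s => phi s + \sum_j F j s)).
  apply: eq_Lint => s _; rewrite cosine_density_frac cosine_densityE.
  rewrite mulrDl mul1r mulr_suml; congr (_ + _); apply: eq_bigr => j _.
  by rewrite /F /cosf /sinf mulrBr cosB; ring.
rewrite (LintD L1_density iS) phi1 LS; congr (_ + _); apply: eq_bigr => j _.
rewrite LintD; try exact: L1Z.
rewrite !LintZ// /fre /fim /cosf /sinf; ring.
Qed.

End convolution.
End alternatives.

(** * Second moment of the mixture *)

Section random_signs.
Context {R : realType}.

(** The sharp bound is [2 * expR (x ^+ 2 / 2)]; the weaker constant follows
    from [1 + x <= expR x] alone. *)
Lemma expR_sym_le (x : R) : expR x + expR (- x) <= 2 * expR (2 * x ^+ 2).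
Proof.
(* For large [x] one has [|x| <= 2 * x ^+ 2], which bounds both exponentials. For small [x],
   [expR y <= (1 - y)^-1] bounds the sum by [2 / (1 - x ^+ 2)], and [(1 - v)^-1 <= 1 + 2 * v] for
   [v] between 0 and [2^-1]. *)
have [x2|x2] := lerP (x ^+ 2) 2^-1; last first.
  have le_abs : `|x| <= 2 * x ^+ 2.
    have x0 : 0 <= `|x| by [].
    rewrite -(real_normK (num_real x)) in x2 *; rewrite leNgt; apply/negP => h.
    have : 1 < `|x| by lra.
    by nra.
  have /andP[xl xr] : - (2 * x ^+ 2) <= x <= 2 * x ^+ 2 by rewrite -ler_norml.
  by rewrite mulr_natl mulr2n lerD// ler_expR// lerNl.
have expR_le (y : R) : y ^+ 2 <= 2^-1 -> expR y <= (1 - y)^-1.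
  move=> y2; have y1 : 0 < 1 - y by nra.
  rewrite -[y in expR y]opprK expRN lef_pV2 ?posrE ?expR_gt0//.
  exact: expR_ge1Dx.
have x1 : 0 < 1 - x by nra.
have x1' : 0 < 1 + x by nra.
have xx : 0 < 1 - x ^+ 2 by nra.
apply: (@le_trans _ _ (2 * (1 - x ^+ 2)^-1)).
  apply: (@le_trans _ _ ((1 - x)^-1 + (1 + x)^-1)).
    by apply: lerD; [exact: expR_le|rewrite -{2}[x]opprK; apply: expR_le; rewrite sqrrN].
  rewrite le_eqVlt; apply/orP; left; apply/eqP; field.
  by rewrite !gt_eqF.
rewrite ler_pM2l//; apply: le_trans (expR_ge1Dx _).
rewrite -div1r ler_pdivrMr//.
have : 0 <= x ^+ 2 by exact: sqr_ge0.
by clear -x2; move: (x ^+ 2) x2 => u; nra.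
Qed.

Definition sgnb (b : bool) : R := if b then 1 else -1.

(** The sum over sign vectors factorises into two-point sums, each equal to
    [expR (y j) + expR (- y j)] whatever the sign [t j]. *)
Lemma sum_expR_signs J (y : 'I_J -> R) (t : {ffun 'I_J -> bool}) :
  \sum_(t' : {ffun 'I_J -> bool}) expR (\sum_j y j * (sgnb (t j) * sgnb (t' j)))
  <= 2 ^+ J * expR (2 * \sum_j y j ^+ 2).
Proof.
under eq_bigr do rewrite expR_sum.
rewrite -(bigA_distr_bigA (fun j b => expR (y j * (sgnb (t j) * sgnb b)))).
rewrite mulr_sumr expR_sum -[J in 2 ^+ J]card_ord -prodr_const -big_split/=.
apply: ler_prod => j _; rewrite big_bool/= addr_ge0 ?expR_ge0//=.
rewrite /sgnb; case: (t j); rewrite !(mulr1,mulrN1,mulN1r,opprK).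
  exact: expR_sym_le.
by rewrite addrC; exact: expR_sym_le.
Qed.

(** From [1 + x <= expR x] the power [c i i' ^+ n] is at most an exponential, which is then averaged
    over signs. Pairs of different blocks contribute at most 1, and the diagonal, a fraction [1 / N]
    of all pairs, adds at most [B]. *)
Lemma mixture_second_moment N J n (k : 'I_N -> 'I_N -> 'I_J -> R)
    (c : 'I_N * {ffun 'I_J -> bool} -> 'I_N * {ffun 'I_J -> bool} -> R) (B : R) :
  (0 < N)%N ->
  (forall i i', c i i' =
    1 + \sum_j k i.1 i'.1 j * (sgnb (i.2 j) * sgnb (i'.2 j))) ->
  (forall i i', 0 <= c i i') ->
  (forall t t' j, t != t' -> k t t' j = 0) ->
  (forall t, expR (2 * \sum_j (n%:R * k t t j) ^+ 2) <= B) ->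
  #|{: 'I_N * {ffun 'I_J -> bool}}|%:R ^- 2 * (\sum_i \sum_i' c i i' ^+ n) <=
  1 + B / N%:R.
Proof.
move=> N0 cE c0 k0 kB.
have cexp i i' : c i i' ^+ n <=
    expR (\sum_j (n%:R * k i.1 i'.1 j) * (sgnb (i.2 j) * sgnb (i'.2 j))).
  under eq_bigr do rewrite -mulrA.
  rewrite -mulr_sumr expRM_natl; apply: lerXn2r; rewrite ?nnegrE ?c0 ?expR_ge0//.
  by rewrite cE expR_ge1Dx.
have inner t t' (s : {ffun 'I_J -> bool}) :
    \sum_(s' : {ffun 'I_J -> bool}) c (t, s) (t', s') ^+ n <=
    2 ^+ J * (1 + (t == t')%:R * B).
  apply: (@le_trans _ _ (2 ^+ J * expR (2 * \sum_j (n%:R * k t t' j) ^+ 2))).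
    apply: le_trans (sum_expR_signs _ s); apply: ler_sum => s' _; exact: cexp.
  rewrite ler_pM2l ?exprn_gt0//; have [<-|tt'] := eqVneq.
    (* On the diagonal [B] is relaxed to [1 + B], so that one formula covers both cases. *)
    by rewrite mul1r (le_trans (kB t))// lerDr.
  by rewrite mul0r addr0 big1 ?mulr0 ?expR0// => j _; rewrite k0// mulr0 expr0n.
have outer : \sum_i \sum_i' c i i' ^+ n <=
    (N%:R * 2 ^+ J) * (2 ^+ J * (N%:R + B)).
  apply: (@le_trans _ _ (\sum_(i : 'I_N * {ffun 'I_J -> bool}) (2 ^+ J * (N%:R + B)))).
    apply: ler_sum => -[t s] _.
    rewrite (eq_bigr (fun p => c (t, s) (p.1, p.2) ^+ n)) => [|[]//].
    rewrite -(pair_bigA _ (fun t' s' => c (t, s) (t', s') ^+ n))/=.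
    apply: (@le_trans _ _ (\sum_(t' < N) 2 ^+ J * (1 + (t == t')%:R * B))).
      by apply: ler_sum => t' _; exact: inner.
    rewrite -mulr_sumr big_split/= sumr_const card_ord -mulr_suml.
    rewrite (bigD1 t)//= eqxx big1 ?addr0 ?mul1r// => t'.
    by rewrite eq_sym => /negbTE ->.
  by rewrite sumr_const card_prod card_ord card_ffun card_bool card_ord
    -[leLHS]mulr_natl natrM natrX.
rewrite card_prod card_ord card_ffun card_bool card_ord natrM natrX.
have NR : 0 < N%:R :> R by rewrite ltr0n.
have JR : 0 < 2 ^+ J :> R by rewrite exprn_gt0.
have NJ : 0 < (N%:R * 2 ^+ J) ^+ 2 :> R by rewrite exprn_gt0// mulr_gt0.
rewrite mulrC ler_pdivrMr//; apply: le_trans outer _.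
rewrite le_eqVlt; apply/orP; left; apply/eqP; field.
by rewrite gt_eqF.
Qed.

End random_signs.

(** * From the mixture to a bound on the worst-case risk *)

Section mixture_risk.
Context {R : realType}.

(** Coefficient sequences live on [nat], while signs exist only for the first [J] indices; beyond
    them the value defaults to 0. *)
Definition signed J (u : nat -> R) (s : {ffun 'I_J -> bool}) (m : nat) : R :=
  if insub m is Some o then u m * sgnb (s o) else 0.

Lemma signedE J (u : nat -> R) (s : {ffun 'I_J -> bool}) (j : 'I_J) :
  signed u s j = u j * sgnb (s j).
Proof. by rewrite /signed valK. Qed.

Lemma signed_sqr J (u : nat -> R) (s : {ffun 'I_J -> bool}) (j : 'I_J) :
  signed u s j ^+ 2 = u j ^+ 2.
Proof. by rewrite signedE exprMn /sgnb; case: (s j); rewrite ?sqrrN expr1n mulr1. Qed.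

Lemma normr_signed J (u : nat -> R) (s : {ffun 'I_J -> bool}) (j : 'I_J) :
  `|signed u s j| = `|u j|.
Proof.
by rewrite signedE normrM /sgnb; case: (s j); rewrite ?normrN normr1 mulr1.
Qed.

Lemma Pr_ge0 (phi : R -> R) n f D b : (forall y, 0 <= Defs.conv f phi y) ->
  (0 <= Pr phi n f D b)%E.
Proof. by move=> c0; apply: iint_ge0 => // s; rewrite lee_fin. Qed.

(** An average is at most a common upper bound. A finite [V] makes all terms finite, and the
    computation then takes place in the reals. *)
Lemma average_le (I : finType) (P0 : \bar R) (P : I -> \bar R) (V : \bar R) :
  (0 < #|I|)%N -> (0 <= P0)%E -> (forall i, 0 <= P i)%E ->
  (forall i, P0 + P i <= V)%E ->
  (P0 + \sum_i (#|I|%:R^-1)%:E * P i <= V)%E.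
Proof.
move=> I0 P00 Pi0 PV; have [i0 _] := card_gt0P I0.
have IR : (#|I|%:R : R) != 0 by rewrite pnatr_eq0 -lt0n.
case: V PV => [v| |] PV; last 2 first.
- exact: leey.
- by have := le_trans (adde_ge0 P00 (Pi0 i0)) (PV i0).
have P0v : (P0 <= v%:E)%E by apply: le_trans (PV i0); rewrite leeDl.
have Piv i : (P i <= v%:E)%E by apply: le_trans (PV i); rewrite leeDr.
have P0E : (P0 = (fine P0)%:E)%E.
  by rewrite fineK// ge0_fin_numE// (le_lt_trans P0v)// ltry.
have PiE i : (P i = (fine (P i))%:E)%E.
  by rewrite fineK// ge0_fin_numE// (le_lt_trans (Piv i))// ltry.
rewrite P0E; under eq_bigr do rewrite PiE -EFinM.
rewrite sumEFin -EFinD lee_fin -mulr_sumr.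
have -> : v = #|I|%:R^-1 * \sum_(i : I) v.
  by rewrite sumr_const -[v *+ _]mulr_natl mulKf.
have -> : fine P0 = #|I|%:R^-1 * \sum_(i : I) fine P0.
  by rewrite sumr_const -[fine P0 *+ _]mulr_natl mulKf.
rewrite -mulrDr -big_split/= ler_pM2l ?invr_gt0 ?ltr0n//.
by apply: ler_sum => i _; rewrite -lee_fin EFinD -P0E -PiE.
Qed.

(** [V] stands for any common upper bound of the error sums, which keeps suprema out of the
    argument. Disjoint supports of the [u t] make different blocks orthogonal, also after
    convolution. *)
Lemma mixture_risk_bound (phi : R -> R) n N J (u : 'I_N -> nat -> R) (B eps : R)
    (D : seq R -> bool) (V : \bar R) :
  density phi -> (0 < N)%N ->
  (forall t t' j, t != t' -> u t j * u t' j = 0) ->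
  (forall t, \sum_(j < J) `|u t j| <= 1) ->
  (forall t, expR (2 * \sum_(j < J)
     (n%:R * (u t j ^+ 2 * fabs2 phi j.+1 / 2)) ^+ 2) <= B) ->
  is_test n D -> 0 < eps ->
  (forall t (s : {ffun 'I_J -> bool}),
    Pr phi n fcirc D true +
    Pr phi n (cosine_density J (signed (u t) s)) D false <= V)%E ->
  ((1 - eps / 2 - (2 * eps)^-1 * (B / N%:R))%:E <= V)%E.
Proof.
move=> dphi N0 udisj u1 uB tD e0 PV.
have phi0 : forall x, I01 x -> 0 <= phi x by case: dphi => _ [].
pose I := ('I_N * {ffun 'I_J -> bool})%type.
pose a (i : I) := signed (u i.1) i.2.
pose g (i : I) := Defs.conv (cosine_density J (a i)) phi.
pose tp (i : I) := trigp J (fun j => a i j * fre phi j.+1)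
                           (fun j => a i j * fim phi j.+1).
have gE i : g i = (fun y => 1 + tp i y) by exact: conv_cosine_density.
have cg i : continuous (g i).
  rewrite gE; apply: continuous_plus; first exact: cst_continuous.
  exact: continuous_trigp.
have mg i : measurable_fun setT (g i) by exact: continuous_measurable_fun.
have g0 i y : 0 <= g i y.
  apply: Rintegral_ge0 => x xI; rewrite mulr_ge0 ?phi0//.
  apply: cosine_density_ge0; under eq_bigr do rewrite normr_signed; exact: u1.
pose c i i' := Lint (fun x => g i x * g i' x).
have c0 i i' : 0 <= c i i' by apply: Rintegral_ge0 => x _; rewrite mulr_ge0.
(* The contribution of frequency [j.+1] to the inner product of two convolved alternatives, without
   the signs. *)
pose k t t' (j : 'I_J) := u t j * u t' j * fabs2 phi j.+1 / 2.
have cE i i' : c i i' =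
    1 + \sum_j k i.1 i'.1 j * (sgnb (i.2 j) * sgnb (i'.2 j)).
  rewrite /c !gE Lint_1trigpM; congr (_ + _); apply: eq_bigr => j _.
  by rewrite /k /a !signedE /fabs2; ring.
have I0 : (0 < #|{: I}|)%N.
  by rewrite card_prod card_ord muln_gt0 N0 card_ffun card_bool expn_gt0.
have kB t : expR (2 * \sum_j (n%:R * k t t j) ^+ 2) <= B.
  by apply: le_trans (uB t); rewrite ler_expR.
have k0 t t' j : t != t' -> k t t' j = 0.
  by move=> tt'; rewrite /k udisj// !mul0r.
have second := mixture_second_moment N0 cE c0 k0 kB.
apply: le_trans (average_le I0 _ _ (fun i : I => PV i.1 i.2)); last 2 first.
- by apply: Pr_ge0 => y; rewrite conv_fcirc.
- by move=> i; apply: Pr_ge0; exact: g0.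
rewrite /Pr conv_fcirc//; apply: le_trans; last first.
  apply: (mixture_lower_bound (c := c) I0 mg g0 _ _ tD e0).
  - by move=> i; rewrite gE integral_L1 ?Lint_1trigp// -gE; exact: L1_continuous.
  - move=> i i'; rewrite integral_L1//; apply: L1_continuous.
    exact: continuous_prod.
rewrite lee_fin lerD2l lerN2 ler_pM2l ?invr_gt0 ?mulr_gt0//.
by rewrite lerBlDl.
Qed.

End mixture_risk.

(** * Dyadic blocks and the calibration of the smoothness *)

Section dyadic_blocks.
Context {R : realType}.

(** Amplitudes are indexed by [j] for the frequency [j.+1], hence the shift. *)
Definition in_block (k j : nat) : bool := (k <= j < k.*2)%N.

Definition block_amplitude (k : nat) (x : R) (j : nat) : R :=
  if in_block k j.+1 then x else 0.

(** The block holds [k] frequencies, and [k.*2 <= J.+1] says that the last one, [2 k - 1], is at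
    most [J]. *)
Lemma sum_block J k (x : R) : (0 < k)%N -> (k.*2 <= J.+1)%N ->
  \sum_(j < J) block_amplitude k x j = k%:R * x.
Proof.
case: k => // k _ kJ; rewrite -(big_mkord xpredT (block_amplitude k.+1 x)).
have kJ' : (k + k.+1 <= J)%N by rewrite -ltnS -addSn addnn.
have kk : (k <= k + k.+1)%N by rewrite leq_addr.
rewrite (big_cat_nat (n := k)) ?(leq_trans kk)//=.
rewrite (big_cat_nat (m := k) (n := k + k.+1))//=.
rewrite big_nat big1 ?add0r => [|j jk]; last first.
  by rewrite /block_amplitude /in_block; case: ifP => //; lia.
rewrite [X in _ + X]big_nat [X in _ + X]big1 ?addr0 => [|j jk]; last first.
  by rewrite /block_amplitude /in_block; case: ifP => //; lia.
rewrite (eq_big_nat _ _ (F2 := fun=> x)) => [|j jk].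
  by rewrite sumr_const_nat addKn mulr_natl.
by rewrite /block_amplitude /in_block; case: ifP => //; lia.
Qed.

Lemma ler_sum_block J k (x : R) (F : nat -> R) : (0 < k)%N -> (k.*2 <= J.+1)%N ->
  (forall j, in_block k j.+1 -> F j <= x) ->
  (forall j, ~~ in_block k j.+1 -> F j = 0) ->
  \sum_(j < J) F j <= k%:R * x.
Proof.
move=> k0 kJ Fx F0; rewrite -(sum_block x k0 kJ); apply: ler_sum => j _.
by rewrite /block_amplitude; case: ifPn => [/Fx|/F0 ->].
Qed.

Lemma powRE (x y : R) : 0 < x -> x `^ y = expR (y * ln x).
Proof. by move=> x0; rewrite /powR gt_eqF. Qed.

Lemma powR_double (x y : R) : x `^ (2 * y) = (x `^ y) ^+ 2.
Proof. by rewrite -powR_mulrn ?powR_ge0// -powRrM mulrC. Qed.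

Lemma powR_anti (x y s : R) : 0 < x -> x <= y -> 0 <= s -> y `^ (- s) <= x `^ (- s).
Proof.
move=> x0 xy s0; have y0 := lt_le_trans x0 xy.
by rewrite !powRE// ler_expR !mulNr lerN2 ler_wpM2l// ler_ln.
Qed.

Variables (p c C A s sl su r : R) (k : nat).
Hypotheses (p0 : 0 < p) (c0 : 0 < c) (C0 : 0 < C) (A0 : 0 < A) (k0 : (0 < k)%N).
Hypotheses (s_ge : 2^-1 < s) (s_le : s <= su).

Let K : R := k%:R.
Let K0 : 0 < K. Proof. by rewrite ltr0n. Qed.

Let powKD (x y : R) : K `^ (x + y) = K `^ x * K `^ y.
Proof. by rewrite powRD// (gt_eqF K0) implybT. Qed.

(** Half of it is the modulus of a Fourier coefficient. With [k] such frequencies the squared norm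
    has order [K ^ (- 2 s)], that of the squared radius. *)
Definition amplitude : R := 2 * (A * K `^ (- (s + 2^-1))).

Local Notation u := (block_amplitude k amplitude).

Lemma amplitude_ge0 : 0 <= amplitude.
Proof. by rewrite /amplitude !mulr_ge0 ?powR_ge0// ltW. Qed.

Lemma K_amplitude_sqr : K * amplitude ^+ 2 = 4 * A ^+ 2 * K `^ (- (2 * s)).
Proof.
transitivity (4 * A ^+ 2 * expR (ln K + 2%:R * (- (s + 2^-1) * ln K))).
  by rewrite expRD expRM_natl lnK ?posrE// /amplitude powRE//; ring.
by rewrite powRE//; congr (_ * expR _); field.
Qed.

Variable J : nat.
Hypothesis kJ : (k.*2 <= J.+1)%N.

(** This keeps the perturbed density nonnegative: the sum is [2 * A * K ^ (2^-1 - s)], and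
    [s > 2^-1] makes the power at most 1. *)
Lemma sum_normr_amplitude : A <= 2^-1 -> \sum_(j < J) `|u j| <= 1.
Proof.
move=> A2; apply: le_trans (@ler_sum_block J k amplitude (fun j => `|u j|) k0 kJ _ _) _.
- by move=> j jk; rewrite /block_amplitude jk ger0_norm ?amplitude_ge0.
- by move=> j /negbTE jk; rewrite /block_amplitude jk normr0.
have -> : k%:R * amplitude = (2 * A) * expR (ln K + - (s + 2^-1) * ln K).
  by rewrite /amplitude powRE// expRD lnK ?posrE//; ring.
rewrite -[leRHS]mulr1 ler_pM ?expR_ge0//.
- by rewrite mulr_ge0// ltW.
- lra.
rewrite expR_le1.
have : 0 <= (s - 2^-1) * ln K by rewrite mulr_ge0 ?ln_ge0 ?ler1n// subr_ge0 ltW.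
rewrite /K; lra.
Qed.

Lemma sum_amplitude_sqr : \sum_(j < J) u j ^+ 2 / 2 = 2 * A ^+ 2 * K `^ (- (2 * s)).
Proof.
have -> : \sum_(j < J) u j ^+ 2 / 2 =
    \sum_(j < J) block_amplitude k (amplitude ^+ 2 / 2) j.
  apply: eq_bigr => j _; rewrite /block_amplitude; case: ifP => // _.
  by rewrite expr0n mul0r.
by rewrite sum_block// mulrA K_amplitude_sqr; field.
Qed.

(** The weights on the block are at most their value at [2 k], which cancels the decay of the
    amplitude up to [(2 ^ s * A) ^+ 2]. Passing to [su] makes the condition on [A] uniform in
    [s]. *)
Lemma sum_ellipsoid_amplitude : 2 * (2 `^ su * A) <= r ->
  \sum_(j < J) (j.+1%:R `^ (- s)) ^- 2 * (u j ^+ 2 / 4) <= r ^+ 2 / 2.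
Proof.
move=> Ar; have s0 : 0 <= s by move: s_ge; lra.
pose x : R := ((k.*2)%:R `^ (- s)) ^- 2 * (amplitude ^+ 2 / 4).
apply: le_trans (@ler_sum_block J k x
  (fun j => (j.+1%:R `^ (- s)) ^- 2 * (u j ^+ 2 / 4)) k0 kJ _ _) _.
- move=> j jk; rewrite /block_amplitude jk /x.
  apply: ler_wpM2r; first by rewrite divr_ge0 ?sqr_ge0.
  have /andP[_ jk2] := jk.
  rewrite lef_pV2 ?posrE ?exprn_gt0 ?powR_gt0 ?ltr0n ?double_gt0//.
  rewrite lerXn2r ?nnegrE ?powR_ge0//.
  by apply: powR_anti; rewrite ?ltr0n// ler_nat ltnW.
- by move=> j /negbTE jk; rewrite /block_amplitude jk expr0n mul0r mulr0.
have -> : k%:R * x = (2 `^ s * A) ^+ 2.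
  rewrite /x -muln2 natrM -/K powRM ?ltW// !powRN exprMn !exprVn invfM !invrK.
  transitivity (2 `^ s ^+ 2 * K `^ s ^+ 2 * (K * amplitude ^+ 2) / 4); first by ring.
  rewrite K_amplitude_sqr powRN powR_double.
  have : K `^ s != 0 by rewrite gt_eqF ?powR_gt0.
  by move=> Ks; field.
have b0 : 0 <= 2 `^ s * A by rewrite mulr_ge0 ?powR_ge0// ltW.
have : 2 `^ s * A <= 2 `^ su * A.
  by rewrite ler_pM2r//; apply: ler_powR => //; rewrite ler1n.
by move: (2 `^ s * A) (2 `^ su * A) Ar b0 => y z; nra.
Qed.

Variable phi : R -> R.
Hypothesis phiC : forall j : nat, (0 < j)%N ->
  c * j%:R `^ (- p) <= fabs phi j%:Z <= C * j%:R `^ (- p).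

Hypothesis dphi : density phi.

Lemma fabs2E j : fabs2 phi j = fabs phi j ^+ 2.
Proof. by rewrite /fabs sqr_sqrtr// /fabs2 addr_ge0 ?sqr_ge0. Qed.

Lemma fabsN j : fabs phi (- j) = fabs phi j.
Proof.
have freqN (x : R) : 2 * pi * (- j)%:~R * x = - (2 * pi * j%:~R * x).
  by rewrite mulrNz mulrN mulNr.
rewrite /fabs /fabs2; congr Num.sqrt.
have -> : fre phi (- j) = fre phi j.
  by apply: eq_Lint => x _; rewrite freqN cosN.
have -> : fim phi (- j) = Lint (fun x => -1 * (phi x * sinf j x)).
  by apply: eq_Lint => x _; rewrite freqN sinN mulrN mulN1r.
rewrite LintZ ?mulN1r ?sqrrN//.
by apply: L1_densityM => //; [exact: continuous_sinf|move=> x; exact: sin_max].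
Qed.

Variable X : R.
Hypothesis KX : K `^ (2 * s + 2 * p + 2^-1) = X.

(** Each term before squaring has order [n K ^ (- 2 s - 2 p - 1)]. Summing [k] squares gives
    [8 * (A * C) ^+ 4 * (n / X) ^+ 2] by the calibration [KX], and [A * C <= 2^-1] bounds the
    constant by [2^-1]. *)
Lemma sum_exponent_amplitude n : A * C <= 2^-1 ->
  2 * \sum_(j < J) (n%:R * (u j ^+ 2 * fabs2 phi j.+1 / 2)) ^+ 2 <=
  2^-1 * (n%:R / X) ^+ 2.
Proof.
move=> AC; have X0 : 0 < X by rewrite -KX powR_gt0.
pose x : R := (n%:R * (amplitude ^+ 2 * (C * K `^ (- p)) ^+ 2 / 2)) ^+ 2.
have le1 : \sum_(j < J) (n%:R * (u j ^+ 2 * fabs2 phi j.+1 / 2)) ^+ 2 <= K * x.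
  apply: (@ler_sum_block J k x (fun j =>
    (n%:R * (u j ^+ 2 * fabs2 phi j.+1 / 2)) ^+ 2)) => // j.
    move=> jk; rewrite /block_amplitude jk fabs2E /x.
    have f0 : 0 <= fabs phi j.+1 by exact: sqrtr_ge0.
    have fC : fabs phi j.+1 <= C * K `^ (- p).
      have /andP[_] := phiC (ltn0Sn j); move=> /le_trans; apply.
      rewrite ler_pM2l//; apply: powR_anti => //; last exact: ltW.
      by rewrite ler_nat; case/andP: jk.
    have f2 : fabs phi j.+1 ^+ 2 <= (C * K `^ (- p)) ^+ 2.
      by rewrite lerXn2r ?nnegrE// (le_trans f0).
    move: (sqr_ge0 amplitude) (sqr_ge0 (fabs phi j.+1)) f2.
    move: (amplitude ^+ 2) (fabs phi j.+1 ^+ 2) ((C * _) ^+ 2) => a f g a0 f_ge0 fg.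
    have afg : n%:R * (a * f / 2) <= n%:R * (a * g / 2).
      by rewrite ler_wpM2l// ler_wpM2r ?invr_ge0// ler_wpM2l.
    have af0 : 0 <= n%:R * (a * f / 2) by rewrite mulr_ge0// divr_ge0// mulr_ge0.
    by apply: lerXn2r; rewrite ?nnegrE// (le_trans af0).
  by move=> /negbTE jk; rewrite /block_amplitude jk expr0n !mul0r mulr0 expr0n.
apply: (@le_trans _ _ (2 * (K * x))); first by rewrite ler_pM2l.
have -> : 2 * (K * x) = 8 * (A * C) ^+ 4 * (n%:R / X) ^+ 2.
  rewrite /x -KX.
  transitivity (2^-1 * K^-1 * n%:R ^+ 2 * (K * amplitude ^+ 2) ^+ 2 *
      (C * K `^ (- p)) ^+ 4); first by field; rewrite gt_eqF.
  rewrite K_amplitude_sqr.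
  have -> : K `^ (- (2 * s)) = (K `^ s) ^- 2.
    by rewrite powRN powR_double.
  have -> : K `^ (2 * s + 2 * p + 2^-1) = (K `^ s) ^+ 2 * (K `^ p) ^+ 2 * K `^ 2^-1.
    by rewrite !powKD !powR_double.
  rewrite powRN.
  (* Writing [K] as the square of its root leaves a rational identity in three positive
     quantities. *)
  have KE : K = (K `^ 2^-1) ^+ 2 by rewrite powR12_sqrt ?ltW// sqr_sqrtr// ltW.
  move: KE (gt_eqF (powR_gt0 s K0)) (gt_eqF (powR_gt0 p K0))
    (gt_eqF (powR_gt0 2^-1 K0)).
  move: (K `^ s) (K `^ p) (K `^ 2^-1) => x1 x2 x3 -> h1 h2 h3.
  by field; rewrite h1 h2 h3.
have AC0 : 0 <= A * C by rewrite mulr_ge0// ltW.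
rewrite ler_wpM2r ?sqr_ge0//.
have : (A * C) ^+ 4 <= (2^-1) ^+ 4 by rewrite lerXn2r ?nnegrE ?invr_ge0.
lra.
Qed.

(** Each of the [k] summands is at most its bound at frequency [k], as the lower bound on [fabs phi]
    decreases. Squares are compared at the end, where [2 * T <= 4 * T] leaves room. *)
Lemma nu_sqr_le : nu phi k ^+ 2 <= 2 * c ^- 2 * K `^ (2 * p + 2^-1).
Proof.
have nu0 : 0 <= nu phi k by exact: powR_ge0.
set S := \sum_(1 <= j < k.+1) (fabs phi j%:Z ^- 4 + fabs phi (- j%:Z) ^- 4).
have S0 : 0 <= S.
  by apply: sumr_ge0 => j _; rewrite addr_ge0// invr_ge0 exprn_ge0// sqrtr_ge0.
have SE : (nu phi k ^+ 2) ^+ 2 = S.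
  rewrite -exprM /nu -/S -powR_mulrn ?powR_ge0// -powRrM.
  by rewrite (_ : 4^-1 * _ = 1) ?powRr1// mulVf.
have term j : (1 <= j < k.+1)%N ->
    fabs phi j%:Z ^- 4 + fabs phi (- j%:Z) ^- 4 <= 2 * (c * K `^ (- p)) ^- 4.
  move=> /andP[j1 jk]; rewrite fabsN.
  have cK : 0 < c * K `^ (- p) by rewrite mulr_gt0// powR_gt0.
  have le_f : c * K `^ (- p) <= fabs phi j.
    have /andP[+ _] := phiC j1; apply: le_trans; rewrite ler_pM2l//.
    by apply: powR_anti; rewrite ?ltr0n ?ler_nat// ltW.
  suff : fabs phi j ^- 4 <= (c * K `^ (- p)) ^- 4 by lra.
  rewrite lef_pV2 ?posrE ?exprn_gt0// ?(lt_le_trans cK)//.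
  by rewrite lerXn2r ?nnegrE// ?ltW// (lt_le_trans cK).
have SB : S <= K * (2 * (c * K `^ (- p)) ^- 4).
  rewrite /S big_nat; apply: le_trans (ler_sum _ term) _.
  by rewrite -big_nat sumr_const_nat subn1 -[leLHS]mulr_natl.
have Y0 : 0 <= 2 * c ^- 2 * K `^ (2 * p + 2^-1).
  have c2 : 0 <= c ^- 2 by rewrite invr_ge0 sqr_ge0.
  by apply: mulr_ge0; [exact: mulr_ge0|exact: powR_ge0].
rewrite -(ler_pXn2r (n := 2)) ?nnegrE ?sqr_ge0// SE; apply: le_trans SB _.
rewrite powKD powRN.
rewrite powR_double.
have KE : K = (K `^ 2^-1) ^+ 2 by rewrite powR12_sqrt ?ltW// sqr_sqrtr// ltW.
have c4 : 0 <= c ^- 4 by rewrite invr_ge0 exprn_ge0// ltW.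
have p4 : 0 <= (K `^ p) ^+ 4 by rewrite exprn_ge0// powR_ge0.
pose T := K * (c ^- 4 * (K `^ p) ^+ 4).
have T0 : 0 <= T by exact: mulr_ge0 (ltW K0) (mulr_ge0 c4 p4).
have -> : K * (2 * (c * (K `^ p)^-1) ^- 4) = 2 * T.
  by rewrite /T; field; rewrite !gt_eqF ?powR_gt0.
have -> : (2 * c ^- 2 * ((K `^ p) ^+ 2 * K `^ 2^-1)) ^+ 2 = 4 * T.
  rewrite /T; move: KE; move: (K `^ p) (K `^ 2^-1) => x1 x2 ->.
  by field; rewrite gt_eqF.
lra.
Qed.

(** The infimum is at most its term at [k], where the calibration [KX] makes both entries of the
    maximum of order [K ^ (- 2 s)]. *)
Lemma rho_le (w : nat -> R) : w k = K `^ (- s) ->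
  rho phi w X <= Num.sqrt ((1 + 2 * c ^- 2) * K `^ (- (2 * s))).
Proof.
move=> wk; have X0 : 0 < X by rewrite -KX powR_gt0.
have h0 : 0 <= 2 * c ^- 2 by rewrite mulr_ge0// invr_ge0 sqr_ge0.
rewrite ler_wsqrtr//; apply: (@le_trans _ _ (Num.max (w k ^+ 2) (nu phi k ^+ 2 / X))).
  apply: ge_inf; last by exists k.
  by exists 0 => _ [j _ <-]; rewrite le_max sqr_ge0.
rewrite ge_max; apply/andP; split.
  have -> : w k ^+ 2 = K `^ (- (2 * s)).
    by rewrite wk -powR_mulrn ?powR_ge0// -powRrM; congr (_ `^ _); ring.
  by rewrite ler_peMl ?powR_ge0// lerDl.
rewrite ler_pdivrMr//; apply: le_trans nu_sqr_le _.
rewrite -KX -[leRHS]mulrA -powKD.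
rewrite (_ : - (2 * s) + _ = 2 * p + 2^-1); last by ring.
by rewrite ler_wpM2r ?powR_ge0// lerDr.
Qed.

End dyadic_blocks.

(** * The range of block indices with admissible smoothness *)

Section dyadic_grid.
Context {R : realType}.

Lemma in_block_inj i i' m : in_block (2 ^ i) m -> in_block (2 ^ i') m -> i = i'.
Proof.
have lt_disj a b : (a < b)%N -> in_block (2 ^ a) m -> in_block (2 ^ b) m -> False.
  move=> ab /andP[_ ma] /andP[bm _].
  have : (2 ^ a.+1 <= 2 ^ b)%N by rewrite leq_exp2l.
  by rewrite expnS mul2n; lia.
by case: (ltngtP i i') => // ii' h h'; [case: (lt_disj _ _ ii')|case: (lt_disj _ _ ii')].
Qed.

(** Chosen so that [(2 ^ i) `^ (2 s + q) = X], see [grid_exponentE]. *)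
Definition grid_exponent (q X : R) (i : nat) : R :=
  (ln X / (i%:R * ln 2) - q) / 2.

Lemma grid_exponentE (q X : R) i : (0 < i)%N -> 0 < X ->
  (2 ^ i)%:R `^ (2 * grid_exponent q X i + q) = X.
Proof.
move=> i0 X0; rewrite powRE ?ltr0n ?expn_gt0//.
rewrite natrX lnXn// -[ln 2 *+ i]mulr_natl -[RHS]lnK ?posrE//; congr expR.
have l2 : ln 2 != 0 :> R by rewrite gt_eqF// ln_gt0// ltr1n.
by rewrite /grid_exponent; field; rewrite l2 pnatr_eq0 -lt0n i0.
Qed.

(** With [l = ln X / ln 2], the exponent at [i] lies in the range as soon as [l / (2 * su + q) <= i
    <= l / (2 * sl + q)], an interval of length [k * l]. *)
Lemma grid_exists (q sl su X : R) : 0 < q -> 0 < sl -> sl < su -> 1 < X ->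
  let k := (2 * sl + q)^-1 - (2 * su + q)^-1 in
  exists i0 N : nat, [/\ (0 < i0)%N,
    k * (ln X / ln 2) - 1 <= N%:R &
    forall t, (t < N)%N -> sl <= grid_exponent q X (i0 + t) <= su].
Proof.
move=> q0 sl0 slu X1 k.
have l2 : 0 < ln 2 :> R by rewrite ln_gt0// ltr1n.
have lX : 0 < ln X by exact: ln_gt0.
set l := ln X / ln 2; have l0 : 0 < l by rewrite divr_gt0.
have a0 : 0 < 2 * sl + q by lra.
have b0 : 0 < 2 * su + q by lra.
pose lo := l / (2 * su + q); pose hi := l / (2 * sl + q).
have lo0 : 0 <= lo by rewrite divr_ge0// ltW.
have kl : k * l = hi - lo by rewrite /hi /lo /k; ring.
have hilo : 0 <= hi - lo.
  rewrite -kl mulr_ge0 ?(ltW l0)// subr_ge0 lef_pV2 ?posrE//; lra.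
(* Starting just above [lo] and taking [truncn (hi - lo)] indices, the last one is at most
   [truncn lo + truncn (hi - lo)], hence at most [hi]. *)
exists (Num.truncn lo).+1, (Num.truncn (hi - lo)); split=> //.
  by rewrite kl lerBlDr natr1 ltW// truncnS_gt.
move=> t tN; set i := (_ + t)%N.
have ilo : lo <= i%:R.
  by apply: le_trans (ltW (truncnS_gt lo)) _; rewrite ler_nat leq_addr.
have ihi : i%:R <= hi.
  have /andP[h1 _] := truncn_itv lo0; have /andP[h2 _] := truncn_itv hilo.
  have : (Num.truncn lo + t.+1)%:R <= (Num.truncn lo + Num.truncn (hi - lo))%:R :> R.
    by rewrite ler_nat leq_add2l.
  by rewrite /i addSnnS !natrD; lra.
have i0 : 0 < i%:R :> R by rewrite ltr0n.
have lE : ln X / (i%:R * ln 2) = l / i%:R by rewrite /l; field; rewrite !gt_eqF.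
have h1 : 2 * sl + q <= l / i%:R.
  by rewrite ler_pdivlMr// mulrC -ler_pdivlMr.
have h2 : l / i%:R <= 2 * su + q.
  by rewrite ler_pdivrMr// mulrC -ler_pdivrMr.
by rewrite /grid_exponent lE; apply/andP; split; lra.
Qed.

End dyadic_grid.

(** * Choice of the constants and assembly of the adaptive lower bound *)

Theorem theorem6p2 (R : realType) (phi : R -> R) (p r sl su : R)
  (AA : set (nat -> R)) :
  density phi ->
  (forall j : int, 0 < fabs phi j) ->
  (exists c C : R, 0 < c /\ c <= C /\ forall j : nat, (0 < j)%N ->
       c * j%:R `^ (- p) <= fabs phi j%:Z <= C * j%:R `^ (- p)) ->
  2^-1 < p ->
  0 < r ->
  2^-1 < sl -> sl < su ->
  (forall a, AA a ->
     (forall j : nat, (0 < j)%N -> 0 < a j <= 1) /\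
     (forall j k : nat, (0 < j)%N -> (j <= k)%N -> a k <= a j)) ->
  (forall s, sl <= s <= su ->
     exists a, AA a /\ forall j : nat, (0 < j)%N -> a j = j%:R `^ (- s)) ->
  forall alpha : R, 0 < alpha < 1 ->
  exists n0 : nat, (0 < n0)%N /\ exists Aa : R, 0 < Aa /\
  forall n : nat, (n0 <= n)%N -> forall A : R, 0 <= A <= Aa ->
  ((1 - alpha)%:E <=
   ereal_inf [set ereal_sup [set risk phi n D (ellipsoid a r)
                              (A * rho phi a (delta n * n%:R)) | a in AA]
             | D in [set D | is_test n D]])%E.
Proof.
move=> dphi _ [c [C [c0 [cC phiC]]]] p2 r0 sl2 slu AA1 AAs alpha /andP[al0 al1].
have C0 : 0 < C by exact: lt_le_trans cC.
pose q := 2 * p + 2^-1.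
have q0 : 0 < q by rewrite /q; lra.
have sl0 : 0 < sl by lra.
pose k := (2 * sl + q)^-1 - (2 * su + q)^-1.
have k0 : 0 < k by rewrite subr_gt0 ltf_pV2 ?posrE; lra.
have su2 : 0 < 2 `^ su :> R by rewrite powR_gt0.
(* The three bounds serve nonnegativity of the densities, membership in the ellipsoid, and the
   second moment. *)
pose A0 := Num.min 2^-1 (Num.min (r / (2 * 2 `^ su)) (2 * C)^-1).
have A00 : 0 < A0.
  by rewrite !lt_min invr_gt0 ltr0n/= divr_gt0 ?mulr_gt0//= invr_gt0 mulr_gt0.
have A0h : A0 <= 2^-1 by rewrite ge_min lexx.
have A0r : 2 * (2 `^ su * A0) <= r.
  have : A0 <= r / (2 * 2 `^ su) by rewrite !ge_min lexx orbT.
  by rewrite ler_pdivlMr ?mulr_gt0// mulrC mulrA.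
have A0C : A0 * C <= 2^-1.
  have : A0 <= (2 * C)^-1 by rewrite !ge_min lexx !orbT.
  by rewrite invfM ler_pdivlMr.
pose b := 1 + 2 * c ^- 2.
have c2 : 0 <= c ^- 2 by rewrite invr_ge0 sqr_ge0.
have b1 : 1 <= b by rewrite /b; lra.
have b0 : 0 < b by lra.
(* A threshold for [ln n]: [expR 1] removes the maximum in [delta], [4 / k] yields at least
   [k * L / 4] blocks, and the last entry brings the chi-square term below [alpha ^+ 2]. *)
pose L0 := Num.max (expR 1) (Num.max (4 / k) ((4 / (k * alpha ^+ 2)) ^+ 2)).
exists (Num.truncn (expR L0)).+1; split=> //.
exists (A0 / b); split; first by rewrite divr_gt0.
move=> n n0n A /andP[A_ge0 A_le].
have nL : expR L0 <= n%:R.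
  by apply: le_trans (ltW (truncnS_gt _)) _; rewrite ler_nat.
have n_gt0 : 0 < n%:R :> R by exact: lt_le_trans (expR_gt0 _) nL.
pose L : R := ln n%:R.
have LL0 : L0 <= L by rewrite -(expRK L0) ler_ln ?posrE ?expR_gt0.
have /and3P[L1 L2 L3] : [&& expR 1 <= L, 4 / k <= L & (4 / (k * alpha ^+ 2)) ^+ 2 <= L].
  by move: LL0; rewrite /L0 !ge_max.
have L_gt0 : 0 < L by exact: lt_le_trans (expR_gt0 _) L1.
have lnL1 : 1 <= ln L by rewrite -(expRK 1) ler_ln ?posrE ?expR_gt0.
have lnL0 : 0 < ln L by lra.
have lnLL : ln L <= L by exact/ltW/ln_sublinear.
have dE : delta n = ln L `^ (- 2^-1) :> R.
  by rewrite /delta -/L; congr (_ `^ _); exact/max_idPl.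
have d0 : 0 < delta n :> R by rewrite dE powR_gt0.
pose X : R := delta n * n%:R.
have X0 : 0 < X by rewrite mulr_gt0.
(* Here [ln X = L - ln (ln L) / 2], and the correction is at most [L / 2]. *)
have lnX : L / 2 <= ln X.
  rewrite lnM ?posrE// dE ln_powR -/L.
  have : ln (ln L) <= ln L by exact/ltW/ln_sublinear.
  lra.
(* The choice of [delta] enters here: the second moment within a block is then at most
   [expR (ln L / 2)], the square root of [L], against order [L] blocks. *)
have nX : (n%:R / X) ^+ 2 = ln L.
  rewrite /X dE powRN invfM invrK mulrA mulrAC mulfV ?gt_eqF// mul1r.
  by rewrite powR12_sqrt ?sqr_sqrtr// ltW.
have X1 : 1 < X by rewrite -(lnK X0) -[1]expR0 ltr_expR; lra.
have [i0 [N [i00 Nge sgrid]]] := grid_exists q0 sl0 slu X1.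
have ln2 : ln 2 <= 1 :> R.
  rewrite -[leRHS](expRK 1) ler_ln ?posrE ?expR_gt0//.
  by apply: le_trans (expR_ge1Dx 1).
have ln20 : 0 < ln 2 :> R by rewrite ln_gt0// ltr1n.
have NL : k * L / 4 <= N%:R.
  apply: le_trans Nge.
  have h1 : L / 2 <= ln X / ln 2.
    by rewrite ler_pdivlMr//; apply: le_trans lnX; rewrite ler_piMr//; lra.
  have h2 : k * (L / 2) <= k * (ln X / ln 2) by rewrite ler_pM2l.
  have h3 : 4 <= k * L by rewrite mulrC -ler_pdivrMr.
  by rewrite -/k; lra.
have N0R : 0 < N%:R :> R by apply: lt_le_trans NL; rewrite divr_gt0 ?mulr_gt0.
have N0 : (0 < N)%N by rewrite -(ltr0n R).
pose s (t : nat) := grid_exponent q X (i0 + t).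
pose K (t : nat) := (2 ^ (i0 + t))%N.
have K0 t : (0 < K t)%N by rewrite expn_gt0.
pose J := (2 ^ (i0 + N))%N.
have KJ (t : 'I_N) : ((K t).*2 <= J.+1)%N.
  apply: leqW; rewrite /K /J -mul2n -expnS leq_exp2l// -addnS leq_add2l.
  exact: ltn_ord.
have KX t : (K t)%:R `^ (2 * s t + 2 * p + 2^-1) = X.
  rewrite -[RHS](@grid_exponentE _ q X (i0 + t)) ?addn_gt0 ?i00//.
  by congr (_ `^ _); rewrite /q /s; ring.
have s2 (t : 'I_N) : 2^-1 < s t.
  by have /andP[+ _] := sgrid _ (ltn_ord t); exact: lt_le_trans.
have ssu (t : 'I_N) : s t <= su by have /andP[] := sgrid _ (ltn_ord t).
pose u (t : 'I_N) := block_amplitude (K t) (amplitude A0 (s t) (K t)).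
apply: le_ereal_inf_tmp => _ [D /= tD <-].
set V := ereal_sup _.
(* Le Cam's bound is used with [eps = alpha], so that each of the two error terms is at most
   [alpha / 2]. *)
suff : ((1 - alpha / 2 - (2 * alpha)^-1 * (expR (2^-1 * ln L) / N%:R))%:E <= V)%E.
  apply: le_trans; rewrite lee_fin.
  have eL : expR (2^-1 * ln L) = Num.sqrt L.
    by rewrite -powRE// powR12_sqrt// ltW.
  have sL0 : 0 < Num.sqrt L by rewrite sqrtr_gt0.
  have sL : 4 / (k * alpha ^+ 2) <= Num.sqrt L.
    have ka0 : 0 < 4 / (k * alpha ^+ 2) by rewrite divr_gt0// mulr_gt0// exprn_gt0.
    rewrite -(ler_pXn2r (n := 2)) ?nnegrE ?(ltW sL0) ?(ltW ka0)//.
    by rewrite sqr_sqrtr// ltW.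
  have chi : expR (2^-1 * ln L) / N%:R <= alpha ^+ 2.
    rewrite eL ler_pdivrMr//.
    have h1 : alpha ^+ 2 * (k * L / 4) <= alpha ^+ 2 * N%:R.
      by rewrite ler_pM2l ?exprn_gt0.
    apply: le_trans h1.
    move: sL; rewrite ler_pdivrMr ?mulr_gt0 ?exprn_gt0// => sL.
    rewrite -[in leRHS](sqr_sqrtr (ltW L_gt0)).
    have : Num.sqrt L * 4 <= Num.sqrt L * (Num.sqrt L * (k * alpha ^+ 2)).
      by rewrite ler_pM2l.
    by move: (Num.sqrt L) => y; lra.
  have : (2 * alpha)^-1 * (expR (2^-1 * ln L) / N%:R) <= (2 * alpha)^-1 * alpha ^+ 2.
    by rewrite ler_pM2l// invr_gt0 mulr_gt0.
  have -> : (2 * alpha)^-1 * alpha ^+ 2 = alpha / 2 by field; rewrite gt_eqF.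
  lra.
apply: (@mixture_risk_bound _ phi n N J u _ _ D) => //.
- move=> t t' j tt'; rewrite /u /block_amplitude.
  case: ifPn => [h|_]; last by rewrite mul0r.
  case: ifPn => [h'|_]; last by rewrite mulr0.
  by have /addnI/val_inj tE := in_block_inj h h'; rewrite tE eqxx in tt'.
- by move=> t; exact: sum_normr_amplitude.
- move=> t; rewrite ler_expR -nX.
  by apply: (sum_exponent_amplitude _ C0 A00 (K0 t) (KJ t) phiC (KX t)) => //; lra.
move=> t e.
(* As [s t] lies in the smoothness range, the power sequence with this exponent is available in
   [AA], and its class contains the mixture component at hand. *)
have [a [AAa aE]] := AAs _ (sgrid _ (ltn_ord t)).
apply: (@le_trans _ _ (risk phi n D (ellipsoid a r) (A * rho phi a X))); last first.
  by apply: ereal_sup_ubound; exists a.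
apply: leeD2l; apply: ereal_sup_ubound; right.
exists (cosine_density J (signed (u t) e)); split; [|split; [|split=> //]].
- apply: density_cosine_density; under eq_bigr do rewrite normr_signed.
  exact: sum_normr_amplitude.
- apply: ellipsoid_cosine_density => [j jJ|].
    by rewrite aE// powR_gt0.
  under eq_bigr do rewrite signed_sqr aE//.
  exact: (sum_ellipsoid_amplitude A00 (K0 t) (s2 t) (ssu t) (KJ t)).
rewrite L2norm_cosine_density; under eq_bigr do rewrite signed_sqr.
rewrite sum_amplitude_sqr//.
have p0 : 0 < p by lra.
have := rho_le p0 c0 (K0 t) phiC dphi (KX t) (aE _ (K0 t)).
rewrite -/b; set Z := _ `^ _ => rhoZ.
have Z0 : 0 <= Z by exact: powR_ge0.
apply: (@le_trans _ _ (A * Num.sqrt (b * Z))); first by rewrite ler_wpM2l.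
rewrite -[A in leLHS](ger0_norm A_ge0) -sqrtr_sqr -sqrtrM ?sqr_ge0//.
apply: ler_wsqrtr; rewrite mulrA ler_wpM2r//.
(* Multiplying this by [A <= A0] bounds [A ^+ 2 * b] by [A0 ^+ 2], which gives the required
   separation. *)
have Ab : A * b <= A0 by rewrite -ler_pdivlMr.
have AA0 : A <= A0 by apply: le_trans Ab; rewrite ler_peMr.
nra.
Qed.
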